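(* Let $n\in\mathbb N$, let $T_n$ be the $n$-regular tree, and let $\Gamma$ be any marked group whose Cayley graph $\mathrm{Cay}(\Gamma)$ is (isomorphic to) $T_n$. Then $T_n$ admits an $\mathrm{Aut}(T_n)$-fiid approximate $\Gamma$-Cayley diagram.
   Context: A marked group is a group $\Gamma$ with a specified finite symmetric generating set $E$, with $e\notin E$. $G=\mathrm{Cay}(\Gamma)$ is the graph with vertex set $\Gamma$ and edge set $F=\{(x,\gamma x):x\in\Gamma,\gamma\in E\}$ (edges are ordered pairs); identify $T_n$ with $G$. $\mathrm{Aut}(G)$ acts on $[0,1]^\Gamma$ and on edge labellings by $f\cdot x=x\circ f^{-1}$. An $\mathrm{Aut}(G)$-fiid edge labelling is a measurable map $\mathbf f$ from $([0,1]^\Gamma,\lambda^\Gamma)$ ($\lambda$ Lebesgue measure) to edge labellings that is $\mathrm{Aut}(G)$-equivariant almost everywhere, viewed as a random labelling. The standard Cayley diagram of $\mathrm{Cay}(\Gamma)$ is the edge labelling $c_{st}(\gamma x,x)=\gamma$ ($x\in\Gamma$, $\gamma\in E$). An $\mathrm{Aut}(G)$-fiid approximate $\Gamma$-Cayley diagram is a sequence $(\mathbf f_i)_{i\in\mathbb N}$ of $\mathrm{Aut}(G)$-fiid edge labellings $F\to E$ such that for every $r\in\mathbb N$, $\mathbb P\big((B_r(e),e,\mathbf f_i\restriction B_r(e))\cong(B_r(e),e,c_{st}\restriction B_r(e))\big)\to1$ as $i\to\infty$, where $\cong$ is isomorphism of rooted edge-labelled graphs. *)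

(* Defs.v *)
From HB Require Import structures.
From mathcomp Require Import all_boot all_order all_algebra finmap.
From mathcomp Require Import all_classical all_reals all_analysis.

Set Implicit Arguments.
Unset Strict Implicit.
Unset Printing Implicit Defensive.

Import Order.TTheory GRing.Theory Num.Theory.

Local Open Scope classical_set_scope.

Section Graph.
Variables (V : eqType) (adj : rel V).

Definition graph_regular (n : nat) := forall x, exists s : seq V,
  [/\ uniq s, size s = n & forall y, adj x y = (y \in s)].

Definition graph_connected := forall x y, exists2 p, path adj x p & last x p = y.

(* Cycles of size 2 are single edges traversed back and forth. *)
Definition graph_acyclic := forall c, ucycle adj c -> (size c <= 2)%N.

(* The n-regular tree T_n is determined by this up to isomorphism (on a
   nonempty vertex set). *)
Definition is_regular_tree n :=
  [/\ symmetric adj, irreflexive adj, graph_connected, graph_acyclic &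
      graph_regular n].

Definition graph_ball (x : V) (r : nat) : set V :=
  [set y | exists p, [/\ path adj x p, last x p = y & (size p <= r)%N]].

End Graph.

Record rooted_lgraph (L : Type) := RootedLGraph {
  rl_vert : Type ;
  rl_root : rl_vert ;
  rl_edge : rl_vert -> rl_vert -> bool ;
  rl_lab : forall u v, rl_edge u v -> L
}.

Definition rooted_lgraph_iso (L : Type) (G H : rooted_lgraph L) :=
  exists phi : rl_vert G -> rl_vert H,
    [/\ bijective phi,
        phi (rl_root G) = rl_root H,
        forall u v, rl_edge (phi u) (phi v) = rl_edge u v &
        forall u v (h : rl_edge u v) (h' : rl_edge (phi u) (phi v)),
          rl_lab h' = rl_lab h].

Record marked_group := MarkedGroup {
  mg_group :> groupType ;
  gens : {fset mg_group} ;
  gens1 : (1%g : mg_group) \notin gens ;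
  gensV : forall g, g \in gens -> (g^-1)%g \in gens ;
  gens_gen : forall x : mg_group,
    exists2 s : seq mg_group, {subset s <= gens} & x = (\prod_(g <- s) g)%g
}.

Section Cayley.
Variable Gamma : marked_group.
Notation E := (gens Gamma).

Definition cay : rel Gamma :=
  fun x y => [exists g : E, y == (val g * x)%g].

Lemma cayE x y : cay x y = ((y * x^-1)%g \in E).
Proof.
apply/existsP/idP => [[g /eqP ->]|h]; first by rewrite mulgK; exact: valP.
by exists [` h]%fset; rewrite /= mulgVK.
Qed.

Lemma cay_sym : symmetric cay.
Proof.
by move=> x y; rewrite !cayE; apply/idP/idP => /gensV; rewrite invgF.
Qed.

Definition cay_edge := {p : Gamma * Gamma | cay p.1 p.2}.

Definition labelling := cay_edge -> E.

Lemma std_label_subproof (u : cay_edge) :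
  ((val u).1 * (val u).2^-1)%g \in E.
Proof. by rewrite -cayE cay_sym; exact: (valP u). Qed.

Definition std_diagram : labelling := fun u => [` std_label_subproof u]%fset.

Lemma std_diagramE (x : Gamma) (g : E) (h : cay (val g * x)%g x) :
  std_diagram (exist _ ((val g * x)%g, x) h) = g.
Proof. by apply: val_inj; rewrite /= mulgK. Qed.

Record cay_aut := CayAut {
  aut_fun :> Gamma -> Gamma ;
  aut_inv : Gamma -> Gamma ;
  aut_funK : cancel aut_fun aut_inv ;
  aut_invK : cancel aut_inv aut_fun ;
  aut_adj : forall x y, cay (aut_fun x) (aut_fun y) = cay x y
}.

Lemma aut_edge_subproof (phi : cay_aut) (u : cay_edge) :
  cay (aut_inv phi (val u).1) (aut_inv phi (val u).2).
Proof. by rewrite -(aut_adj phi) !aut_invK; exact: (valP u). Qed.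

Definition aut_edge_inv (phi : cay_aut) (u : cay_edge) : cay_edge :=
  exist _ (aut_inv phi (val u).1, aut_inv phi (val u).2)
        (aut_edge_subproof phi u).

Definition act_vertex (T : Type) (phi : cay_aut) (x : Gamma -> T) :=
  x \o aut_inv phi.

Definition act_edge (phi : cay_aut) (c : labelling) : labelling :=
  c \o aut_edge_inv phi.

Lemma cay_ball_root r : 1%g \in graph_ball cay 1%g r.
Proof. by apply/mem_set; exists [::]. Qed.

Definition labelled_ball (r : nat) (c : labelling) : rooted_lgraph E :=
  @RootedLGraph E (set_type (graph_ball cay 1%g r))
    (SigSub (cay_ball_root r))
    (fun u v => cay (val u) (val v))
    (fun u v h => c (exist _ (val u, val v) h)).

End Cayley.

HB.instance Definition _ (R : realType) := isPointed.Build {i01 R} 0%:i01%R.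

Section ProductSpace.
Variables (R : realType) (I : choiceType).

Definition coordinate_sets : set (set (I -> {i01 R})) :=
  [set A | exists i (B : set R),
     measurable B /\ A = [set x | B (x i)%:num%R]].

(* [0,1]^I with its product sigma-algebra *)
Definition cube := g_sigma_algebraType coordinate_sets.

(* lam is the power lambda^I of Lebesgue measure on [0,1]; since finite
   dimensional boxes form a generating pi-system, this determines lam. *)
Definition is_lebesgue_power (lam : probability cube R) :=
  forall (J : {fset I}) (B : I -> set R),
    (forall i, measurable (B i)) ->
    lam [set x | forall i, i \in J -> B i (x i)%:num%R] =
    (\prod_(i <- J) lebesgue_measure (B i `&` `[0%R, 1%R]))%E.

End ProductSpace.

Section Fiid.
Variables (R : realType) (Gamma : marked_group).
Variable lam : probability (cube R Gamma) R.

(* The sets of labellings [set c | c u = l] generate the product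
   sigma-algebra on labellings, the label set being finite. *)
Definition measurable_labelling (f : cube R Gamma -> labelling Gamma) :=
  forall u l, measurable [set x | f x u = l].

(* A single null set serves all automorphisms. *)
Definition ae_equivariant (f : cube R Gamma -> labelling Gamma) :=
  {ae lam, forall x, forall phi : cay_aut Gamma,
     f (act_vertex phi x) = act_edge phi (f x)}.

Definition is_fiid_labelling (f : cube R Gamma -> labelling Gamma) :=
  measurable_labelling f /\ ae_equivariant f.

Definition is_fiid_approx_cayley_diagram
    (f : nat -> cube R Gamma -> labelling Gamma) :=
  (forall i, is_fiid_labelling (f i)) /\
  forall r : nat,
    lam [set x | rooted_lgraph_iso (labelled_ball r (f i x))
                                   (labelled_ball r (@std_diagram Gamma))]
      @[i --> \oo] --> 1%E.

End Fiid.

(* Main.v *)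
From HB Require Import structures.
Require Import Defs.
From mathcomp Require Import all_boot all_order all_algebra finmap.
From mathcomp Require Import all_classical all_reals all_analysis.
From mathcomp Require Import fingroup perm zify lra.

(** Label the half-edges of the tree: an edge [u v] carries a label [a] at [u]
    and the label [a^-1] at [v], and a labelling of all edges is locally a
    copy of the standard diagram as soon as every vertex sees each label exactly
    once.  Start from the empty labelling and add edges to it; the amount to be
    made small is the expected number of labels missing at the root, because
    the union bound over a ball and [complete_iso] then turn a small amount
    into a ball isomorphic to the standard one with high probability.

    The tool for adding an edge is the two-coloured chain from Koenig's theorem
    on edge colourings of bipartite graphs.  If [u] misses a label, it has a
    neighbour [v] joined to it by an unlabelled edge, and [v] misses some label
    too; exchanging two labels along a chain starting at [v] frees the label
    at [v] that is needed for the edge [u v].  A tree is bipartite, so that the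
    chain does not reach [u] ([kempe_repair]).  The exchange is a finite
    operation only if the chain ends.  But long chains are rare: a chain that
    starts at [v] is determined by any vertex of given parity on it, so by mass transport
    the probability that a given vertex starts a chain with more than [k]
    double steps is at most [1/(k+1)], for every invariant random labelling
    ([Pr_long_chain]).  Hence, when the expected number of missing labels is
    at least [e > 0], a proportion of the vertices that depends on [e] only can be
    repaired inside a ball whose radius depends on [e] only.

    Repairs have to be made in an equivariant way and without conflicts.  The
    random labels are discretised so finely that the vertices of a large ball
    around the root mostly get distinct colours.  A repair can then be described by
    a code, that is, by a relabelling in terms of colours; distinct repairs
    with the same code are disjoint, so all of them can be made at once
    ([round]), and the finitely many codes are treated one after another.  A
    repair that is possible at the beginning is made, or one of its vertices is
    changed earlier; in both cases a repair is made nearby, and each one gains a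
    label ([pass]).  Thus a pass lowers the expected number of missing labels by an
    amount that stays bounded below as long as this number is at least a
    given [e] ([improve]), and finitely many passes bring it below [e]
    ([small_deficit]).

    After finitely many rounds each label is a function of finitely many
    discretised coordinates ([local]), which makes it measurable, and all
    constructions are expressed in terms of the graph and the colours only,
    which makes them equivariant under every automorphism, at every point. *)

Set Implicit Arguments.
Unset Strict Implicit.
Unset Printing Implicit Defensive.

Import Order.TTheory GRing.Theory Num.Theory.
Import numFieldNormedType.Exports.

(** * Trees and partial labellings *)

Section Trees.
Variables (V : eqType) (adj : rel V).

(** A repeated vertex splits a closed walk into two shorter ones, one of which
    has odd length if the whole does.  A shortest odd closed walk therefore has
    no repetition, and acyclicity leaves only a loop. *)
Lemma acyclic_no_odd_cycle c :
  irreflexive adj -> graph_acyclic adj -> odd (size c) -> ~ path.cycle adj c.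
Proof.
move=> irr acyc; have [k] := ubnP (size c).
elim: k c => // k IHk c; rewrite ltnS => sck oddc cyc.
have [Uc|/uniqPn] := boolP (uniq c).
  have := acyc c; rewrite /ucycle cyc Uc => /(_ isT).
  case: c oddc cyc {sck Uc} => [|x [|y [|z c]]] //= _.
  by rewrite irr.
case: c oddc cyc sck => [|x0 c0]; first by [].
set c := x0 :: c0 => oddc cyc sck /(_ x0)[i [j [ij jc eqij]]].
have ic : (i < size c)%N by exact: ltn_trans jc.
pose x := nth x0 c i.
have rotE : rot i c = x :: (drop i.+1 c ++ take i c).
  by rewrite /rot (drop_nth x0 ic).
have : x \in drop i.+1 c ++ take i c.
  rewrite mem_cat; apply/orP; left; apply/(nthP x0); exists (j - i.+1)%N.
    by rewrite size_drop ltn_sub2r// (leq_ltn_trans _ jc).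
  by rewrite nth_drop subnKC.
move=> xs; move: cyc oddc sck; rewrite -(rot_cycle i) -(size_rot i) rotE.
case/splitPr: xs => c1 c2.
rewrite /= rcons_cat /= cat_path /= => /and3P[p1 e1 p2] oddc sck.
have c1P : path.cycle adj (x :: c1) by rewrite /= rcons_path p1.
have c2P : path.cycle adj (x :: c2) by [].
move: oddc sck; rewrite size_cat /= addnS /= oddD negbK.
case o1 : (odd (size c1)); case o2 : (odd (size c2)) => //= _ sck.
  by apply: (IHk (x :: c2)) => //=; rewrite ?o2 //; lia.
by apply: (IHk (x :: c1)) => //=; rewrite ?o1 //; lia.
Qed.

(** The parity of any walk from the root will do: two such walks that end at
    adjacent vertices with the same parity would close up to an odd cycle. *)
Lemma tree_bipartite (x0 : V) :
  symmetric adj -> irreflexive adj -> graph_connected adj ->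
  graph_acyclic adj ->
  exists h : V -> bool, forall u v, adj u v -> h u != h v.
Proof.
move=> sym irr con acyc.
have hP v : exists p, path adj x0 p && (last x0 p == v).
  by have [p pp <-] := con x0 v; exists p; rewrite pp eqxx.
exists (fun v => odd (size (projT1 (cid (hP v))))) => u v uv.
case: (cid (hP u)) => pu /= /andP[pu1 /eqP pu2].
case: (cid (hP v)) => pv /= /andP[pv1 /eqP pv2].
apply/negP => /eqP parity.
pose q := pu ++ v :: rev (belast x0 pv).
have qP : path adj x0 q.
  rewrite cat_path pu1 pu2 /= uv -pv2 rev_path.
  by rewrite (eq_path (e' := adj)) // => a b; exact: sym.
have lq : last x0 q = x0.
  rewrite last_cat /= -pv2; case: (pv) => //= a l.
  by rewrite rev_cons last_rcons.
have oq : odd (size q).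
  by rewrite size_cat /= size_rev size_belast addnS /= oddD parity addbb.
case/lastP: q lq oq qP => // q y; rewrite last_rcons => -> oq qP.
apply: (@acyclic_no_odd_cycle (x0 :: q)) => //.
by move: oq; rewrite size_rcons.
Qed.

Lemma gball_refl x r : graph_ball adj x r x.
Proof. by exists [::]. Qed.

Lemma gball1 x y r : adj x y -> graph_ball adj x r.+1 y.
Proof. by move=> xy; exists [:: y]; rewrite /= xy. Qed.

Lemma gball_le x y r s : (r <= s)%N -> graph_ball adj x r y -> graph_ball adj x s y.
Proof. by move=> rs [p [pp pl sp]]; exists p; split=> //; exact: leq_trans rs. Qed.

Lemma gball_trans x y z r s :
  graph_ball adj x r y -> graph_ball adj y s z -> graph_ball adj x (r + s) z.
Proof.
move=> [p [pp pl sp]] [q [qp ql sq]]; exists (p ++ q).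
by rewrite cat_path last_cat size_cat pl pp qp leq_add.
Qed.

Lemma gball_sym x y r :
  symmetric adj -> graph_ball adj x r y -> graph_ball adj y r x.
Proof.
move=> sym [p [pp pl sp]]; exists (rev (belast x p)).
rewrite size_rev size_belast sp -pl rev_path; split=> //.
- by rewrite (eq_path (e' := adj)) // => a b; exact: sym.
- by case: (p) => //= a l; rewrite rev_cons last_rcons.
Qed.

End Trees.

Section PartialLabelling.
Variable Gamma : marked_group.
Notation E := (gens Gamma).
Implicit Types (u v w : Gamma) (a b p q : E).

Definition ginv a : E := [` gensV (valP a)]%fset.

Lemma ginvK : involutive ginv.
Proof. by move=> a; apply: val_inj; rewrite /= invgK. Qed.

(** The label of an edge is attached to its ends: [c u v = Some a] means that
    the edge joining [u] and [v] carries [a] at its end [u], so that [v] takes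
    the place of [a * u] in the structure under construction. *)
Definition partial_labelling := Gamma -> Gamma -> option E.
Implicit Types (c t : partial_labelling).

Definition coherent c := forall u v a, c u v = Some a ->
  [/\ cay u v, c v u = Some (ginv a) & forall v', c u v' = Some a -> v' = v].

Definition has_label c u a : bool := `[< exists v, cay u v /\ c u v = Some a >].

Definition deficit c u := #|[pred a | ~~ has_label c u a]|.

(** Substituting the rows of [t] for those of [c] at the vertices of [S] lowers
    the number of missing labels in [S].  The fourth clause, no change on the
    edges that leave [S], is what makes disjoint repairs compatible.  Only
    edges starting in [S] are read, so that the condition is unaffected by what
    happens to the other vertices. *)
Definition repair c (S : {fset Gamma}) t :=
  [/\ forall u v a, u \in S -> t u v = Some a -> cay u v,
      forall u v a, u \in S -> v \in S ->
        t u v = Some a -> t v u = Some (ginv a),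
      forall u v v' a, u \in S -> t u v = Some a -> t u v' = Some a -> v' = v,
      forall u v, u \in S -> v \notin S -> cay u v -> t u v = c u v &
      (\sum_(u <- S) deficit t u < \sum_(u <- S) deficit c u)%N].

Lemma has_labelP c u a : coherent c ->
  reflect (exists v, c u v = Some a) (has_label c u a).
Proof.
move=> cc; apply: (iffP (asboolP _)) => [[v [_ ?]]|[v cuv]]; exists v => //.
by have [] := cc _ _ _ cuv.
Qed.

(** An edge leaving [S] keeps its label because it can be read from its outer
    end, where the two labellings agree. *)
Lemma repair_coherent c t (S : {fset Gamma}) r :
  coherent c -> coherent t ->
  (forall u v, u \notin S -> t u v = c u v) ->
  (forall u, deficit t u <= deficit c u)%N ->
  r \in S -> (deficit t r < deficit c r)%N -> repair c S t.
Proof.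
move=> cc ct off le rS ltr; split.
- by move=> u v a _ /ct[].
- by move=> u v a _ _ /ct[].
- by move=> u v v' a _ /ct[_ _ h] /h.
- move=> u v uS vS _.
  case tuv : (t u v) => [a|].
    have [_ tvu _] := ct _ _ _ tuv.
    by have [_] := cc _ _ _ (esym (etrans (esym tvu) (off v u vS))); rewrite ginvK => ->.
  case cuv : (c u v) => [a|] //.
  have [_ cvu _] := cc _ _ _ cuv.
  by have [_] := ct _ _ _ (etrans (off v u vS) cvu); rewrite ginvK tuv.
- rewrite (big_fsetD1 r) //= [ltnRHS](big_fsetD1 r) //=.
  rewrite -addSn; apply: leq_add => //.
  by apply: leq_sum => u _; exact: le.
Qed.

Lemma cayM u a : cay u (val a * u)%g.
Proof. by apply/existsP; exists a. Qed.

(** The neighbours of a vertex are in bijection with the labels; if all the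
    edges at [u] were labelled, their labels would give an injective, hence
    surjective, selfmap of the label set. *)
Lemma missing_unlabelled c u a : coherent c ->
  ~~ has_label c u a -> exists2 v, cay u v & c u v = None.
Proof.
move=> cc; apply: contraNP => nov.
have tot b : c u (val b * u)%g <> None by move=> e; apply: nov; exists (val b * u)%g => //; exact: cayM.
pose l b := odflt a (c u (val b * u)%g).
have lE b : c u (val b * u)%g = Some (l b).
  by rewrite /l; case: (c u (val b * u)%g) (tot b).
have linj : injective l.
  move=> b b' e; apply: val_inj; apply: (mulIg u).
  have [_ _ h] := cc _ _ _ (lE b').
  by apply: h; rewrite lE e.
have := injF_onto linj a; case/codomP => b ab.
by apply/(has_labelP _ _ cc); exists (val b * u)%g; rewrite lE ab.
Qed.

(** Dually, a vertex with all its labels spends them on distinct neighbours,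
    which are then all of its neighbours. *)
Lemma unlabelled_missing c u v : coherent c ->
  cay u v -> c u v = None -> exists a, ~~ has_label c u a.
Proof.
move=> cc uv cuv; apply: contrapT => nomiss.
have tot a : exists b, c u (val b * u)%g = Some a.
  have : has_label c u a by apply: contrapT => /negP h; apply: nomiss; exists a.
  move/asboolP => [w [/existsP[b /eqP ->] ?]]; by exists b.
pose l a := projT1 (cid (tot a)).
have lE a : c u (val (l a) * u)%g = Some a by exact: (projT2 (cid (tot a))).
have linj : injective l.
  by move=> a b e; have := lE a; rewrite e lE => -[].
case/existsP: (uv) => b /eqP vE.
have /codomP[a bE] := injF_onto linj b.
by have := lE a; rewrite -bE -vE cuv.
Qed.

Definition nbr c u a : option Gamma :=
  if pselect (exists v, c u v = Some a) is left P then Some (projT1 (cid P))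
  else None.

Lemma nbrP c u a v : coherent c -> (nbr c u a = Some v) <-> (c u v = Some a).
Proof.
move=> cc; rewrite /nbr; case: pselect => [P|N]; last first.
  by split => // h; case: N; exists v.
have e := projT2 (cid P); split=> [[<-] //|h].
by have [_ _ /(_ _ e) ->] := cc _ _ _ h.
Qed.

(** Two steps of the chain that exchanges [p] and [q] at [u]: leave [u] through
    the label [p], then leave the next vertex through [ginv q], that is, enter
    [w] through [q].  At the vertex in the middle the exchanged labels are
    [ginv p] and [ginv q].  Counting double steps spares keeping track of the
    parity. *)
Definition chain_step c p q u : option Gamma :=
  obind (fun w => nbr c w (ginv q)) (nbr c u p).

Definition chain_iter c p q k u : option Gamma :=
  iter k (obind (chain_step c p q)) (Some u).

Lemma chain_stepP c p q u w : coherent c ->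
  (chain_step c p q u = Some w) <->
  (exists2 y, c u y = Some p & c w y = Some q).
Proof.
move=> cc; rewrite /chain_step; split.
  case e : (nbr c u p) => [y|] //= /(nbrP _ _ _ cc) h; exists y.
    by apply/nbrP.
  by have [_ ] := cc _ _ _ h; rewrite ginvK.
move=> [y /(nbrP _ _ _ cc) -> /= /cc[_ h _]]; exact/nbrP.
Qed.

Lemma chain_iter_ball c p q k u w : coherent c ->
  chain_iter c p q k u = Some w -> graph_ball (@cay Gamma) u (2 * k) w.
Proof.
move=> cc; rewrite /chain_iter; elim: k w => [w [<-]|k IHk w]; first exact: gball_refl.
rewrite iterS; case e : (iter k _ _) => [z|] //= /(chain_stepP _ _ _ _ cc)[y zy wy].
rewrite mulnS addnC; apply: gball_trans (IHk _ e) _.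
have [zy' _ _] := cc _ _ _ zy; have [wy' _ _] := cc _ _ _ wy.
by apply: (@gball_trans _ _ _ y _ 1 1); apply: gball1 => //; rewrite cay_sym.
Qed.

Section Kempe.
Variables (h : Gamma -> bool) (c : partial_labelling).
Hypotheses (hP : forall u v, cay u v -> h u != h v) (cc : coherent c).
Variables (e v : Gamma) (a q : E).
Let p := ginv a.
Hypotheses (ev : cay e v) (cev : c e v = None).
Hypotheses (ea : ~~ has_label c e a) (vq : ~~ has_label c v q).
Variable k : nat.
Hypothesis short : chain_iter c p q k v = None.

Definition even_chain : seq Gamma :=
  pmap (fun j => chain_iter c p q j v) (iota 0 k).
Definition odd_chain : seq Gamma := pmap (fun w => nbr c w p) even_chain.

Lemma even_chainP w :
  reflect (exists2 j, (j < k)%N & chain_iter c p q j v = Some w)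
          (w \in even_chain).
Proof.
rewrite mem_pmap; apply: (iffP mapP) => [[j]|[j jk jw]].
  by rewrite mem_iota /= add0n => jk jw; exists j.
by exists j => //; rewrite mem_iota.
Qed.

Lemma odd_chainP y :
  reflect (exists2 w, w \in even_chain & c w y = Some p) (y \in odd_chain).
Proof.
rewrite mem_pmap; apply: (iffP mapP) => -[w we wy]; exists w => //.
  by apply/nbrP.
by apply/esym/nbrP.
Qed.

Lemma even_chain_head : v \in even_chain.
Proof.
apply/even_chainP; exists 0%N => //; case: k short => //.
Qed.

Lemma even_chain_step w w' :
  w \in even_chain -> chain_step c p q w = Some w' -> w' \in even_chain.
Proof.
move=> /even_chainP[j jk jw] ww'; apply/even_chainP; exists j.+1.
  rewrite ltn_neqAle jk andbT; apply/eqP => jk'.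
  by move: short; rewrite -jk' /chain_iter iterS -/(chain_iter c p q j v) jw /= ww'.
by rewrite /chain_iter iterS -/(chain_iter c p q j v) jw.
Qed.

Lemma even_chain_pred w : w \in even_chain -> w != v ->
  exists2 w', w' \in even_chain & chain_step c p q w' = Some w.
Proof.
move=> /even_chainP[[|j] jk jw].
  by case: jw => ->; rewrite eqxx.
move=> _; move: jw; rewrite /chain_iter iterS.
case jw : (iter j _ _) => [z|] //= zw; exists z => //.
by apply/even_chainP; exists j => //; exact: ltnW.
Qed.

Lemma even_chain_h w : w \in even_chain -> h w = h v.
Proof.
case/even_chainP => j _; elim: j w => [w [->] //|j IHj w].
rewrite /chain_iter iterS; case jz : (iter j _ _) => [z|] //= /(chain_stepP _ _ _ _ cc)[y zy wy].
have [/hP zy' _ _] := cc zy; have [/hP wy' _ _] := cc wy.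
by rewrite -(IHj _ jz); move: zy' wy'; case: (h z); case: (h y); case: (h w).
Qed.

Lemma odd_chain_h y : y \in odd_chain -> h y = ~~ h v.
Proof.
case/odd_chainP => w /even_chain_h <- /cc[/hP wy _ _].
by move: wy; case: (h w); case: (h y).
Qed.

(** The even vertices of the chain lie on the side of [v]. *)
Lemma even_chain_e : e \notin even_chain.
Proof.
by apply/negP => /even_chain_h ehv; move: (hP ev); rewrite ehv eqxx.
Qed.

(** The chain enters its odd vertices through the label [ginv p = a], which [e]
    misses. *)
Lemma odd_chain_e : e \notin odd_chain.
Proof.
apply: contra ea => /odd_chainP[w _ /cc[_ ]]; rewrite ginvK => ew _.
by apply/has_labelP => //; exists w.
Qed.

(** The chain leaves an even vertex through [p].  It has entered it through [q],
    except at its start [v], which misses [q]. *)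
Lemma even_chain_closed w y b : w \in even_chain -> c w y = Some b ->
  (b == p) || (b == q) -> y \in odd_chain.
Proof.
move=> we wy /orP[/eqP bE|/eqP bE]; rewrite {}bE {b} in wy.
  by apply/odd_chainP; exists w.
have [wv|/(even_chain_pred we)[w' we' /(chain_stepP _ _ _ _ cc)[y' w'y' wy']]] := eqVneq w v.
  by case/negP: vq; apply/has_labelP => //; exists y; rewrite -wv.
have [_ _ /(_ _ wy') <-] := cc wy; by apply/odd_chainP; exists w'.
Qed.

(** The chain enters an odd vertex through [ginv p] and leaves it through
    [ginv q], since it is short enough not to be cut off. *)
Lemma odd_chain_closed y w b : y \in odd_chain -> c y w = Some b ->
  (b == ginv p) || (b == ginv q) -> w \in even_chain.
Proof.
move=> /odd_chainP[z ze zy] yw /orP[/eqP bE|/eqP bE]; rewrite {}bE {b} in yw.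
  by have [_ yz _] := cc zy; have [_ _ /(_ _ yz) <-] := cc yw.
apply: (even_chain_step ze); apply/chain_stepP => //; exists y => //.
by have [_] := cc yw; rewrite ginvK.
Qed.

Definition kempe_perm u : {perm E} :=
  if u \in even_chain then tperm p q
  else if u \in odd_chain then tperm (ginv p) (ginv q) else 1%g.

Lemma tperm_ginv b : tperm (ginv p) (ginv q) (ginv b) = ginv (tperm p q b).
Proof. by rewrite -(inj_tperm _ _ _ (inv_inj ginvK)). Qed.

Lemma tperm_id (b b1 b2 : E) : (b == b1) || (b == b2) = false -> tperm b1 b2 b = b.
Proof. by case: tpermP => // ->; rewrite ?eqxx ?orbT. Qed.

(** The two ends of an edge prescribe the same new label: an edge of the chain
    gets exchanged labels at both ends, and an edge with one end only on the
    chain carries neither of the two labels that are exchanged there. *)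
Lemma kempe_perm_ginv u w b : c u w = Some b ->
  kempe_perm w (ginv b) = ginv (kempe_perm u b).
Proof.
move=> uw; have [uwh wu _] := cc uw; have := hP uwh; rewrite /kempe_perm.
have [we|we] := boolP (w \in even_chain); have [ue|ue] := boolP (u \in even_chain).
- by rewrite (even_chain_h we) (even_chain_h ue) eqxx.
- have [uo _|uo _] := boolP (u \in odd_chain).
    by rewrite -[tperm p q _]ginvK -tperm_ginv ginvK.
  rewrite perm1 tperm_id //; apply/negP => /(even_chain_closed we wu).
  by rewrite (negbTE uo).
- have [wo _|wo _] := boolP (w \in odd_chain); first exact: tperm_ginv.
  rewrite perm1 tperm_id //; apply/negP => /(even_chain_closed ue uw).
  by rewrite (negbTE wo).
- have [wo|wo] := boolP (w \in odd_chain); have [uo|uo] := boolP (u \in odd_chain).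
  + by rewrite (odd_chain_h wo) (odd_chain_h uo) eqxx.
  + rewrite perm1 tperm_id //; apply/negP => /(odd_chain_closed wo wu).
    by rewrite (negbTE ue).
  + rewrite perm1 tperm_id //; apply/negP => /(odd_chain_closed uo uw).
    by rewrite (negbTE we).
  + by rewrite !perm1.
Qed.

Definition kempe_swap : partial_labelling :=
  fun u w => omap (kempe_perm u) (c u w).

Lemma kempe_swapP u w b :
  (kempe_swap u w = Some b) <-> (c u w = Some ((kempe_perm u)^-1%g b)).
Proof.
rewrite /kempe_swap; case: (c u w) => [b'|] //=; split=> -[].
  by move=> <-; rewrite permK.
by move=> ->; rewrite permKV.
Qed.

Lemma kempe_swap_coherent : coherent kempe_swap.
Proof.
move=> u w b; rewrite kempe_swapP => uw; have [uwh wu inj] := cc uw; split=> //.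
  by rewrite /kempe_swap wu /= (kempe_perm_ginv uw) permKV.
by move=> w'; rewrite kempe_swapP => /inj.
Qed.

Lemma kempe_swap_deficit u : deficit kempe_swap u = deficit c u.
Proof.
rewrite /deficit -[RHS](card_imset _ (@perm_inj _ (kempe_perm u))).
apply: eq_card => b.
apply/idP/finset.imsetP => [|[b' b'N ->]].
  rewrite inE => bN.
  exists ((kempe_perm u)^-1%g b); last by rewrite permKV.
  rewrite !inE; apply: contra bN => /(has_labelP _ _ cc)[w uw].
  by apply/has_labelP; [exact: kempe_swap_coherent|exists w; apply/kempe_swapP].
rewrite !inE in b'N; apply: contra b'N => /(has_labelP _ _ kempe_swap_coherent)[w].
by rewrite kempe_swapP permK => uw; apply/has_labelP => //; exists w.
Qed.

Definition add_edge : partial_labelling := fun u w =>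
  if (u == e) && (w == v) then Some a
  else if (u == v) && (w == e) then Some p
  else kempe_swap u w.

Lemma kempe_swap_e w b : kempe_swap e w = Some b -> b != a.
Proof.
rewrite /kempe_swap /kempe_perm (negbTE even_chain_e) (negbTE odd_chain_e).
case ew : (c e w) => [b'|] //= -[]; rewrite perm1 => <-.
by apply: contra ea => /eqP <-; apply/has_labelP => //; exists w.
Qed.

Lemma kempe_swap_v w b : kempe_swap v w = Some b -> b != p.
Proof.
rewrite kempe_swapP /kempe_perm even_chain_head tpermV => vw.
apply: contra vq => /eqP bp; rewrite bp tpermL in vw.
by apply/has_labelP => //; exists w.
Qed.

Lemma kempe_e_v : (e == v) = false.
Proof. by apply/eqP => e_v; move: (hP ev); rewrite e_v eqxx. Qed.

Lemma add_edge_coherent : coherent add_edge.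
Proof.
have kc := kempe_swap_coherent.
have ne := kempe_e_v; have nv : (v == e) = false by rewrite eq_sym.
move=> u w b; rewrite /add_edge; case: ifP => [/andP[/eqP-> /eqP->]|n1].
  move=> [<-]; rewrite nv !eqxx; split=> // w'.
  rewrite ?eqxx ?ne ?nv /=; case: eqP => // _ /kempe_swap_e; by rewrite eqxx.
case: ifP => [/andP[/eqP-> /eqP->]|n2].
  move=> [<-]; rewrite ginvK !eqxx; split=> //; first by rewrite cay_sym.
  move=> w'; rewrite ?eqxx ?nv /=; case: eqP => // _ /kempe_swap_v; by rewrite eqxx.
move=> uw; have [uwh wu inj] := kc _ _ _ uw; split=> //.
  by rewrite andbC n2 andbC n1.
move=> w'; case: ifP => [/andP[/eqP ue _] [ab]|_].
  by move: uw; rewrite ue -ab => /kempe_swap_e; rewrite eqxx.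
case: ifP => [/andP[/eqP ue _] [ab]|_]; last exact: inj.
by move: uw; rewrite ue -ab => /kempe_swap_v; rewrite eqxx.
Qed.

Lemma kempe_unlabelled : kempe_swap e v = None /\ kempe_swap v e = None.
Proof.
rewrite /kempe_swap cev; split=> //; case ve : (c v e) => [b|] //.
by have [_] := cc ve; rewrite cev.
Qed.

Lemma add_edge_has_label u b : has_label kempe_swap u b -> has_label add_edge u b.
Proof.
move=> /(has_labelP _ _ kempe_swap_coherent)[w uw].
apply/has_labelP; first exact: add_edge_coherent.
have [k1 k2] := kempe_unlabelled.
exists w; rewrite /add_edge; case: ifP => [/andP[/eqP ue /eqP wv]|_].
  by move: uw; rewrite ue wv k1.
case: ifP => [/andP[/eqP ue /eqP wv]|_] //.
by move: uw; rewrite ue wv k2.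
Qed.

Lemma add_edge_deficit_le u : (deficit add_edge u <= deficit c u)%N.
Proof.
rewrite -kempe_swap_deficit; apply/subset_leq_card/fintype.subsetP => b; rewrite !inE.
by apply: contra; exact: add_edge_has_label.
Qed.

Lemma add_edge_deficit_lt : (deficit add_edge e < deficit c e)%N.
Proof.
rewrite -kempe_swap_deficit; apply: proper_card; apply/fintype.properP; split.
  by apply/fintype.subsetP => b; rewrite !inE; apply: contra; exact: add_edge_has_label.
exists a; rewrite !inE.
  apply/negP => /(has_labelP _ _ kempe_swap_coherent)[w] /kempe_swap_e.
  by rewrite eqxx.
rewrite negbK; apply/has_labelP; first exact: add_edge_coherent.
by exists v; rewrite /add_edge !eqxx.
Qed.

(** After the exchange along the chain, [v] misses [p] while [e] still misses
    [a = ginv p], and the edge between them can be labelled.  An exchange does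
    not alter the number of missing labels, and the new edge lowers it at both
    ends. *)
Lemma kempe_repair : exists (S : {fset Gamma}) t,
  [/\ repair c S t, e \in S &
      forall w, w \in S -> graph_ball (@cay Gamma) e (2 * k).+2 w].
Proof.
pose S := [fset w in e :: even_chain ++ odd_chain]%fset.
have SE w : (w \in S) = [|| w == e, w \in even_chain | w \in odd_chain].
  by rewrite /S !in_fsetE.
exists S, add_edge; split.
- apply: (@repair_coherent _ _ _ e) => //.
  + exact: add_edge_coherent.
  + move=> u w; rewrite SE !negb_or => /and3P[ue uev uod].
    rewrite /add_edge (negbTE ue) /=; case: eqP => [uv|_] /=.
      by move: uev; rewrite uv even_chain_head.
    rewrite /kempe_swap /kempe_perm (negbTE uev) (negbTE uod).
    by case: (c u w) => //= b; rewrite perm1.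
  + exact: add_edge_deficit_le.
  + by rewrite SE eqxx.
  + exact: add_edge_deficit_lt.
- by rewrite SE eqxx.
have evB w : w \in even_chain -> graph_ball (@cay Gamma) e (2 * k).+1 w.
  move=> /even_chainP[j jk jw].
  apply: (@gball_trans _ _ _ v _ 1 (2 * k)); first exact: gball1.
  apply: gball_le (chain_iter_ball cc jw); lia.
move=> w; rewrite SE => /or3P[/eqP->|/evB we|/odd_chainP[z /evB ze /cc[zw _ _]]].
- exact: gball_refl.
- exact: gball_le we.
- rewrite -addn1; apply: gball_trans ze _; exact: gball1.
Qed.

End Kempe.

End PartialLabelling.

(** * Simultaneous repairs *)

Section Rounds.
Variable Gamma : marked_group.
Notation E := (gens Gamma).
Notation ball := (graph_ball (@cay Gamma)).
Implicit Types (u v w : Gamma) (a b p q : E) (S : {fset Gamma}).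
Implicit Types (c t : partial_labelling Gamma).

Lemma eq_has_label c c' u u' a :
  (forall v, cay u v -> exists2 v', cay u' v' & c' u' v' = c u v) ->
  has_label c u a -> has_label c' u' a.
Proof.
move=> h /asboolP[v [uv cuv]]; have [v' uv' e] := h v uv.
by apply/asboolP; exists v'; rewrite e.
Qed.

Lemma eq_deficit c c' u :
  (forall v, cay u v -> c' u v = c u v) -> deficit c' u = deficit c u.
Proof.
move=> h; apply: eq_card => a; rewrite !inE; congr negb.
by apply/idP/idP; apply: eq_has_label => v uv; exists v => //; rewrite h.
Qed.

Lemma eq_repair c c' t t' S :
  (forall u v, u \in S -> cay u v -> c' u v = c u v) ->
  (forall u v, u \in S -> t' u v = t u v) ->
  repair c S t -> repair c' S t'.
Proof.
move=> hc ht [r1 r2 r3 r4 r5]; split.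
- by move=> u v a uS; rewrite ht //; exact: r1.
- by move=> u v a uS vS; rewrite !ht //; exact: r2.
- by move=> u v v' a uS; rewrite !ht //; exact: r3.
- by move=> u v uS vS uv; rewrite ht // hc //; exact: r4.
- rewrite [ltnLHS](_ : _ = \sum_(u <- S) deficit t u)%N.
    rewrite [ltnRHS](_ : _ = \sum_(u <- S) deficit c u)%N //.
    by apply: eq_big_seq => u uS; apply: eq_deficit => v; exact: hc.
  by apply: eq_big_seq => u uS; apply: eq_deficit => v _; exact: ht.
Qed.

Section Round.
Variables (K : finType) (r : nat).
Implicit Types (d : Gamma -> K).

(** A description of a repair that does not mention vertices: the colours of the
    vertices of its set, and the new label of an edge in terms of the colours of
    its ends. *)
Definition round_code := ({set K} * {ffun K * K -> option E})%type.
Implicit Types (D : round_code).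

Definition decoded d D : partial_labelling Gamma :=
  fun u v => if cay u v then D.2 (d u, d v) else None.

Definition well_separated d S :=
  (forall u v, u \in S -> v \in S -> ball u r v) /\
  (forall u, u \in S ->
     forall v w, ball u r v -> ball u r w -> d v = d w -> v = w).

Definition repairable d D c S :=
  [/\ well_separated d S, forall k, (k \in D.1) <-> (exists2 u, u \in S & d u = k) &
      repair c S (decoded d D)].

Definition active d D c u := exists2 S, repairable d D c S & u \in S.

Definition round d D c : partial_labelling Gamma :=
  fun u v => if `[< active d D c u >] then decoded d D u v else c u v.

(** Colours are injective around each vertex of [S], so that [S] consists of the
    vertices near [u] whose colours occur in the code. *)
Lemma repairable_sub d D c S S' u :
  repairable d D c S -> repairable d D c S' -> u \in S -> u \in S' ->
  {subset S <= S'}.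
Proof.
move=> [[s1 s2] s3 _] [[s1' _] s3' _] uS uS' v vS.
have /s3' [w wS' wv] : d v \in D.1 by apply/s3; exists v.
by rewrite (s2 u uS v w) //; [exact: s1|exact: s1'].
Qed.

Lemma repairable_eq d D c S S' u :
  repairable d D c S -> repairable d D c S' -> u \in S -> u \in S' -> S = S'.
Proof.
move=> h h' uS uS'; apply/fsetP => v; apply/idP/idP.
  exact: (repairable_sub h h' uS uS').
exact: (repairable_sub h' h uS' uS).
Qed.

Lemma round_active d D c u v : active d D c u -> round d D c u v = decoded d D u v.
Proof. by move=> h; rewrite /round asboolT. Qed.

Lemma round_inactive d D c u v : ~ active d D c u -> round d D c u v = c u v.
Proof. by move=> h; rewrite /round asboolF. Qed.

Lemma repairable_boundary d D c S u v a : coherent c ->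
  repairable d D c S -> u \in S -> v \notin S ->
  decoded d D u v = Some a <-> c u v = Some a.
Proof.
move=> cc [_ _ [r1 _ _ r4 _]] uS vS; split=> h.
  by rewrite -(r4 u v) //; exact: r1 h.
by rewrite (r4 u v) //; have [] := cc _ _ _ h.
Qed.

(** Distinct repairs with the same code have disjoint sets, and each of them
    leaves the edges that join its set to the rest as they were. *)
Lemma round_coherent d D c : coherent c -> coherent (round d D c).
Proof.
move=> cc u v a.
have [[S SP uS]|uA] := pselect (active d D c u).
  rewrite round_active; last by exists S.
  move=> uv; have [_ _ [r1 r2 r3 _ _]] := SP; split; first exact: r1 uv.
    have [vS|vS] := boolP (v \in S).
      by rewrite round_active; [exact: r2|exists S].
    have := uv; rewrite (repairable_boundary _ cc SP uS vS) => cuv.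
    have [_ cvu _] := cc _ _ _ cuv.
    have [[S' SP' vS']|vA] := pselect (active d D c v); last by rewrite round_inactive.
    rewrite round_active; last by exists S'.
    have uS' : u \notin S'.
      by apply: contra vS => uS'; rewrite (repairable_eq SP SP' uS uS').
    by rewrite (repairable_boundary _ cc SP' vS' uS').
  move=> v'; rewrite round_active; [exact: r3 uv|by exists S].
rewrite round_inactive // => cuv; have [uv cvu inj] := cc _ _ _ cuv; split=> //.
  have [[S' SP' vS']|vA] := pselect (active d D c v); last by rewrite round_inactive.
  rewrite round_active; last by exists S'.
  have uS' : u \notin S' by apply/negP => uS'; apply: uA; exists S'.
  by rewrite (repairable_boundary _ cc SP' vS' uS').
by move=> v'; rewrite round_inactive //; exact: inj.
Qed.

Lemma round_deficit_lt d D c S : repairable d D c S ->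
  (\sum_(u <- S) deficit (round d D c) u < \sum_(u <- S) deficit c u)%N.
Proof.
move=> SP; have [_ _ [_ _ _ _ lt]] := SP.
rewrite [ltnLHS](_ : _ = \sum_(u <- S) deficit (decoded d D) u)%N //.
apply: eq_big_seq => u uS; apply: eq_deficit => v _.
by rewrite round_active //; exists S.
Qed.

Lemma round_deficit_inactive d D c u :
  ~ active d D c u -> deficit (round d D c) u = deficit c u.
Proof. by move=> uA; apply: eq_deficit => v _; rewrite round_inactive. Qed.

Lemma repair_code d c S t : (0 < r)%N -> well_separated d S -> repair c S t ->
  exists D, repairable d D c S.
Proof.
move=> r0 sep rep; have [s1 s2] := sep.
pose P (kl : K * K) (uv : Gamma * Gamma) :=
  [/\ uv.1 \in S, cay uv.1 uv.2, d uv.1 = kl.1 & d uv.2 = kl.2].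
pose f : {ffun K * K -> option E} := [ffun kl =>
  if pselect (exists uv, P kl uv) is left h
  then t (projT1 (cid h)).1 (projT1 (cid h)).2 else None].
pose T := [set k : K | `[< exists2 u, u \in S & d u = k >]].
exists (T, f); split=> //=.
  by move=> k; rewrite inE; split => [/asboolP|h] //; apply/asboolP.
apply: eq_repair (rep) => // u v uS; rewrite /decoded /=.
case: ifP => uv; last first.
  by case tuv : (t u v) => [a|] //; have [/(_ _ _ _ uS tuv)] := rep; rewrite uv.
rewrite ffunE; case: pselect => [h|[]]; last by exists (u, v).
have [] := projT2 (cid h); move: (projT1 (cid h)) => [u' v'] /= u'S uv' uu' vv'.
have ? : u' = u.
  by apply: (s2 u uS) => //; [exact: s1|exact: gball_refl].
subst u'; congr t; apply: (s2 u uS) => //; case: (r) r0 => // r' _; exact: gball1.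
Qed.

Definition move (phi : cay_aut Gamma) c : partial_labelling Gamma :=
  fun u v => c (aut_inv phi u) (aut_inv phi v).

Lemma deficit_move (phi : cay_aut Gamma) c c' u :
  (forall v w, c' (phi v) (phi w) = c v w) ->
  deficit c' (phi u) = deficit c u.
Proof.
move=> h; apply: eq_card => a; rewrite !inE; congr negb.
apply/idP/idP; apply: eq_has_label => v uv.
  exists (aut_inv phi v); first by rewrite -(aut_adj phi) aut_invK.
  by rewrite -h aut_invK.
by exists (phi v); rewrite ?aut_adj // h.
Qed.

Lemma aut_inj (phi : cay_aut Gamma) : injective phi.
Proof. exact: can_inj (@aut_funK _ phi). Qed.

Lemma ball_move (phi : cay_aut Gamma) u k v :
  ball (phi u) k (phi v) <-> ball u k v.
Proof.
split=> -[p [pp pl sp]].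
  exists (map (aut_inv phi) p); rewrite size_map; split=> //.
    rewrite -[u](@aut_funK _ phi) path_map.
    by rewrite (eq_path (e' := @cay Gamma)) // => y z /=; rewrite -(aut_adj phi) !aut_invK.
  by rewrite -[u](@aut_funK _ phi) last_map pl aut_funK.
exists (map phi p); rewrite size_map; split=> //.
  rewrite path_map (eq_path (e' := @cay Gamma)) // => y z /=; exact: aut_adj.
by rewrite last_map pl.
Qed.

Lemma repairable_move (phi : cay_aut Gamma) d d' D c c' S :
  (forall v, d' (phi v) = d v) -> (forall v w, c' (phi v) (phi w) = c v w) ->
  repairable d D c S ->
  repairable d' D c' [fset phi u | u in S]%fset.
Proof.
move=> hd hc [[s1 s2] s3 [r1 r2 r3 r4 r5]].
have hD v w : decoded d' D (phi v) (phi w) = decoded d D v w.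
  by rewrite /decoded aut_adj !hd.
have onto v : exists w, v = phi w by exists (aut_inv phi v); rewrite aut_invK.
have memS v : (phi v \in [fset phi u | u in S]%fset) = (v \in S).
  by rewrite mem_imfset //=; exact: aut_inj.
split; first split.
- by move=> _ _ /imfsetP[u /= uS ->] /imfsetP[v /= vS ->]; apply/ball_move; exact: s1.
- move=> _ /imfsetP[u /= uS ->] v w.
  have [v' ->] := onto v; have [w' ->] := onto w.
  by rewrite !ball_move !hd => uv uw e; rewrite (s2 u uS v' w').
- move=> k; rewrite s3; split=> [[u uS <-]|[_ /imfsetP[u /= uS ->] <-]].
    by exists (phi u); rewrite ?memS.
  by exists u.
- split.
  + move=> u v a; have [u' ->] := onto u; have [v' ->] := onto v.
    by rewrite memS hD aut_adj; exact: r1.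
  + move=> u v a; have [u' ->] := onto u; have [v' ->] := onto v.
    by rewrite !memS !hD; exact: r2.
  + move=> u v w a; have [u' ->] := onto u; have [v' ->] := onto v; have [w' ->] := onto w.
    by rewrite memS !hD => uS uv uw; rewrite (r3 u' v' w' a).
  + move=> u v; have [u' ->] := onto u; have [v' ->] := onto v.
    by rewrite !memS !hD hc aut_adj; exact: r4.
  + rewrite !big_imfset /=; try by move=> ? ? _ _; exact: aut_inj.
    rewrite (eq_bigr (deficit (decoded d D))); last by move=> u _; exact: deficit_move.
    by rewrite [ltnRHS](eq_bigr (deficit c)) // => u _; exact: deficit_move.
Qed.

Lemma aut_inv_adj (phi : cay_aut Gamma) u v :
  cay (aut_inv phi u) (aut_inv phi v) = cay u v.
Proof. by rewrite -(aut_adj phi) !aut_invK. Qed.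

Definition aut_rev (phi : cay_aut Gamma) : cay_aut Gamma :=
  CayAut (@aut_invK _ phi) (@aut_funK _ phi) (aut_inv_adj phi).

Lemma active_move (phi : cay_aut Gamma) d d' D c c' u :
  (forall v, d' (phi v) = d v) -> (forall v w, c' (phi v) (phi w) = c v w) ->
  active d D c u -> active d' D c' (phi u).
Proof.
move=> hd hc [S SP uS]; exists [fset phi u | u in S]%fset.
  exact: repairable_move SP.
by rewrite mem_imfset //; exact: aut_inj.
Qed.

Lemma round_move (phi : cay_aut Gamma) d D c :
  round (d \o aut_inv phi) D (move phi c) = move phi (round d D c).
Proof.
apply/funext => u; apply/funext => v; rewrite {2}/move /round.
have -> : `[< active (d \o aut_inv phi) D (move phi c) u >] =
          `[< active d D c (aut_inv phi u) >].
  apply/asbool_equiv_eq; split=> h.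
    apply: (@active_move (aut_rev phi) (d \o aut_inv phi) d D (move phi c) c) => //.
  rewrite -[u](@aut_invK _ phi); apply: active_move h.
    by move=> w; rewrite /= aut_funK.
  by move=> w z; rewrite /move !aut_funK.
by case: ifP => // _; rewrite /decoded /= aut_inv_adj.
Qed.

Lemma active_local d d' D c c' u :
  (forall v, ball u (2 * r).+1 v -> d' v = d v) ->
  (forall v w, ball u r v -> cay v w -> c' v w = c v w) ->
  active d D c u -> active d' D c' u.
Proof.
move=> hd hc [S [[s1 s2] s3 rep] uS]; exists S => //.
have hS v : v \in S -> d' v = d v.
  by move=> vS; apply: hd; apply: gball_le (s1 _ _ uS vS); lia.
split; first split => //.
- move=> v vS w z vw vz; rewrite !hd; first exact: (s2 v).
    by apply: gball_le (gball_trans (s1 _ _ uS vS) vz); lia.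
  by apply: gball_le (gball_trans (s1 _ _ uS vS) vw); lia.
- by move=> k; rewrite s3; split=> -[v vS <-]; exists v => //; rewrite hS.
- apply: eq_repair rep => v w vS; first by apply: hc; exact: s1.
  rewrite /decoded; case: ifP => // vw; rewrite !hd //.
    apply: gball_le (gball_trans (s1 _ _ uS vS) (gball1 0 vw)); lia.
  by apply: gball_le (s1 _ _ uS vS); lia.
Qed.

(** Whether [u] takes part in a repair is decided by what is seen around [u]. *)
Lemma round_local d d' D c c' u v :
  (forall v, ball u (2 * r).+1 v -> d' v = d v) ->
  (forall v w, ball u r v -> cay v w -> c' v w = c v w) ->
  c' u v = c u v ->
  round d' D c' u v = round d D c u v.
Proof.
move=> hd hc cuv; rewrite /round.
have -> : `[< active d' D c' u >] = `[< active d D c u >].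
  apply/asbool_equiv_eq; split; apply: active_local => // *; apply/esym.
    exact: hd.
  exact: hc.
rewrite cuv /decoded; case: ifP => // _; case: ifP => // uv; rewrite !hd //.
  exact: gball1.
exact: gball_refl.
Qed.

Definition rounds d c (l : seq round_code) := foldl (fun c D => round d D c) c l.

(** As long as no vertex of [S] is active, the rows of [c] in [S] do not change
    and the repair stays available; when its own code [D] comes up, the
    vertices of [S] are active. *)
Lemma repair_touched d c S t l D : (exists u, u \in S) ->
  repairable d D c S -> D \in l ->
  exists l1 D' l2 u, [/\ l = l1 ++ D' :: l2, u \in S &
                         active d D' (rounds d c l1) u].
Proof.
move=> S0; elim: l c => // D0 l IHl c SP; rewrite inE => Dl.
have [[u [uS uA]]|nA] := pselect (exists u, u \in S /\ active d D0 c u).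
  by exists [::], D0, l, u.
have {}Dl : D \in l.
  case/orP: Dl => // /eqP e; case: nA; have [u uS] := S0; exists u; split => //.
  by rewrite -e; exists S.
have [] := IHl (round d D0 c) _ Dl.
  have [s1 s2 rep] := SP; split=> //; apply: eq_repair rep => // u v uS _.
  by rewrite round_inactive // => uA; apply: nA; exists u.
move=> l1 [D' [l2 [u [-> uS uA]]]]; exists (D0 :: l1), D', l2, u; split=> //.
Qed.

End Round.
End Rounds.

Local Open Scope classical_set_scope.
Local Open Scope ring_scope.

(** * Finitely determined functions on the cube *)

Section Discretisation.
Variable R : realType.

(** The cell of [r] when the unit interval is cut into [N+1] half-open cells of
    the same length; the endpoint 1 lies in a cell of its own, whence the
    bound [N+2]. *)
Definition disc N (r : R) : 'I_N.+2 := inord (Num.truncn (N.+1%:R * r)).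

Definition disc_itv N (k : nat) : set R :=
  [set` `[k%:R / N.+1%:R, k.+1%:R / N.+1%:R[].

Lemma discE N (r : R) (k : 'I_N.+2) : 0 <= r <= 1 ->
  disc N r = k <-> disc_itv N k r.
Proof.
move=> /andP[r0 r1]; rewrite /disc_itv /= in_itv /=.
have N0 : 0 < N.+1%:R :> R by rewrite ltr0n.
rewrite ler_pdivrMr // ltr_pdivlMr // mulrC.
rewrite -truncn_eq ?mulr_ge0 //.
have tr : (Num.truncn (N.+1%:R * r) < N.+2)%N.
  by rewrite truncn_lt_nat ?mulr_ge0 // (@le_lt_trans _ _ N.+1%:R) ?ltr_nat // ler_piMr.
split=> [<-|/eqP e]; first by rewrite /disc inordK.
by apply: val_inj; rewrite /disc /= inordK.
Qed.

Lemma measurable_disc_itv N k : measurable (disc_itv N k).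
Proof. exact: measurable_itv. Qed.

Lemma disc_itv_le N k :
  (lebesgue_measure (disc_itv N k `&` `[0%R, 1%R]) <= (N.+1%:R^-1)%:E)%E.
Proof.
apply: le_trans (_ : lebesgue_measure (disc_itv N k) <= _)%E.
  apply: le_measure; last by move=> ? [].
    by apply/mem_set; apply: measurableI; exact: measurable_itv.
  by apply/mem_set; exact: measurable_itv.
rewrite /disc_itv lebesgue_measure_itv /= lte_fin.
case: ifP => _; last by rewrite lee_fin invr_ge0.
by rewrite -EFinB lee_fin -mulrBl -natrB // subSnn mul1r.
Qed.

End Discretisation.

Section Cube.
Variables (R : realType) (Gamma : marked_group).
Notation X := (cube R Gamma).
Implicit Types (x y : X) (u v w : Gamma).

Definition act (phi : cay_aut Gamma) (x : X) : X := act_vertex phi x.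

Definition box (J : {fset Gamma}) (B : Gamma -> set R) : set X :=
  [set x | forall i, i \in J -> B i (x i)%:num%R].

Definition boxes : set (set X) :=
  [set A | exists J B, (forall i, measurable (B i)) /\ A = box J B].

Lemma measurable_coord u (B : set R) :
  measurable B -> measurable [set x : X | B (x u)%:num].
Proof. by move=> mB; apply: sub_sigma_algebra; exists u, B. Qed.

Lemma measurable_box J B : (forall i, measurable (B i)) -> measurable (box J B).
Proof.
move=> mB; rewrite (_ : box J B = \bigcap_(i in [set` J]) [set x : X | B i (x i)%:num]).
  by apply: fin_bigcap_measurable => // i _; exact: measurable_coord.
by apply/seteqP; split=> x h i; exact: h.
Qed.

Lemma measurable_act phi : measurable_fun setT (act phi).
Proof.
apply: (@measurability _ _ X X setT (act phi) (@coordinate_sets R Gamma)) => // _ [_ [i [B [mB ->]]] <-].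
rewrite setTI; exact: (@measurable_coord (aut_inv phi i) B mB).
Qed.

HB.instance Definition _ phi := isMeasurableFun.Build _ _ _ _ (act phi) (measurable_act phi).

Variable lam : probability X R.
Hypothesis lamP : is_lebesgue_power lam.

Lemma lam_box J B : (forall i, measurable (B i)) ->
  lam (box J B) = (\prod_(i <- J) lebesgue_measure (B i `&` `[0%R, 1%R]))%E.
Proof. exact: lamP. Qed.

(** Both sides agree on finite boxes, which are stable under intersection and
    generate the sigma-algebra. *)
Lemma act_measure phi (A : set X) : measurable A ->
  lam (act phi @^-1` A) = lam A.
Proof.
move=> mA.
apply: (@g_sigma_algebra_measure_unique _ R X boxes _ (fun=> setT) _ _
          (pushforward lam (act phi)) lam).
- by move=> _ [J [B [mB ->]]]; exact: measurable_box.
- move=> _; exists fset0, (fun=> setT); split=> //.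
  by apply/seteqP; split=> // x _ i; rewrite inE.
- by apply/seteqP; split=> // x _; exists 0%N.
- move=> _ _ [J [B [mB ->]]] [J' [B' [mB' ->]]].
  exists (J `|` J')%fset, (fun i => (if i \in J then B i else setT) `&`
                                    (if i \in J' then B' i else setT)).
  split; first by move=> i; apply: measurableI; case: ifP.
  apply/seteqP; split=> x.
    by move=> [h h'] i _; split; case: ifP => // ?; [exact: h|exact: h'].
  move=> h; split=> i iJ; have := h i; rewrite in_fsetU iJ ?orbT => /(_ isT)[]; by [].
- move=> _ [J [B [mB ->]]]; transitivity (lam (act phi @^-1` box J B)); first by [].
  rewrite (_ : _ @^-1` _ = box [fset aut_inv phi i | i in J]%fset (B \o phi)).
    rewrite !lam_box //; last by move=> i; exact: mB.
    rewrite big_imfset /=; last by move=> i j _ _; exact: (can_inj (@aut_invK _ phi)).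
    by rewrite [RHS]lam_box //; apply: eq_bigr => i _; rewrite aut_invK.
  apply/seteqP; split=> x h.
    by move=> _ /imfsetP[i /= iJ ->]; rewrite aut_invK; exact: h.
  move=> i iJ; have := h (aut_inv phi i).
  by rewrite /= aut_invK; apply; apply/imfsetP; exists i.
- by move=> _; rewrite [X in (X < _)%E]probability_setT ltry.
- apply: sub_sigma_algebra2 mA => _ [i [B [mB ->]]].
  exists [fset i]%fset, (fun=> B); split=> //; apply/seteqP; split=> x h.
    by move=> j; rewrite in_fset1 => /eqP->.
  by apply: h; rewrite in_fset1.
Qed.

Section Local.
Variable T : Type.
Implicit Types f : X -> T.

Definition agree (J : seq (Gamma * nat)) x y := forall j, j \in J ->
  disc j.2 (x j.1)%:num = disc j.2 (y j.1)%:num.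

(** Finitely many coordinates, each known up to the discretisation, determine
    [f].  Such functions take their values on countably many cylinders, so that
    they are all measurable, whatever their codomain. *)
Definition local f := exists J, forall x y, agree J x y -> f x = f y.

End Local.

Lemma agree_cat J J' x y : agree (J ++ J') x y -> agree J x y /\ agree J' x y.
Proof. by move=> h; split=> j jJ; apply: h; rewrite mem_cat jJ ?orbT. Qed.

Lemma local_cst T (t : T) : local (fun=> t).
Proof. by exists [::]. Qed.

Lemma local_comp T T' (f : X -> T) (h : T -> T') : local f -> local (h \o f).
Proof. by move=> [J hJ]; exists J => x y /hJ /= ->. Qed.

Lemma local_comp2 T1 T2 T' (f1 : X -> T1) (f2 : X -> T2) (h : T1 -> T2 -> T') :
  local f1 -> local f2 -> local (fun x => h (f1 x) (f2 x)).
Proof.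
move=> [J hJ] [J' hJ']; exists (J ++ J') => x y /agree_cat[/hJ -> /hJ' ->] //.
Qed.

Lemma local_all (I : eqType) T (s : seq I) (f : I -> X -> T) :
  (forall i, local (f i)) ->
  exists J, forall x y, agree J x y -> {in s, forall i, f i x = f i y}.
Proof.
move=> lf; elim: s => [|i s [J hJ]]; first by exists [::] => x y _ i.
have [J' hJ'] := lf i; exists (J' ++ J) => x y /agree_cat[h h'] j.
by rewrite inE => /predU1P[->|js]; [exact: hJ'|exact: hJ].
Qed.

Lemma local_act T phi (f : X -> T) : local f -> local (f \o act phi).
Proof.
move=> [J hJ]; exists [seq (aut_inv phi j.1, j.2) | j <- J] => x y xy.
by apply: hJ => j jJ; apply: (xy (aut_inv phi j.1, j.2)); apply/mapP; exists j.
Qed.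

Definition sample (J : seq (Gamma * nat)) x : seq nat :=
  [seq (disc j.2 (x j.1)%:num : nat) | j <- J].

Lemma i01_itv (r : {i01 R}) : 0 <= r%:num <= 1.
Proof. by apply/andP; split. Qed.

Lemma measurable_sample J s : measurable [set x | sample J x = s].
Proof.
elim: J s => [|[u N] J IHJ] [|k s].
- by rewrite (_ : [set _ | _] = setT) //; apply/seteqP; split.
- by rewrite (_ : [set _ | _] = set0) //; apply/seteqP; split.
- by rewrite (_ : [set _ | _] = set0) //; apply/seteqP; split.
have [kN|kN] := ltnP k N.+2; last first.
  rewrite (_ : [set _ | _] = set0) //; apply/seteqP; split=> // x [/= e _].
  by move: kN; rewrite -e leqNgt ltn_ord.
rewrite (_ : [set _ | _] = [set x | disc_itv N k (x u)%:num] `&`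
                           [set x | sample J x = s]).
  by apply: measurableI => //; apply: measurable_coord; exact: measurable_disc_itv.
apply/seteqP; split=> x /=.
  move=> [e1 e2]; split=> //.
  have /discE := i01_itv (x u); move=> /(_ N (Ordinal kN))[+ _]; apply.
  exact: val_inj.
move=> [xu ->]; congr cons.
by have /discE := i01_itv (x u) => /(_ N (Ordinal kN))[_ ->].
Qed.

Lemma agree_sample J x y : sample J x = sample J y -> agree J x y.
Proof. by move=> /eq_in_map h j /h/val_inj. Qed.

Lemma local_measurable (P : X -> Prop) : local P -> measurable [set x | P x].
Proof.
move=> [J hJ].
rewrite (_ : [set x | P x] = \bigcup_n
   [set x | P x /\ choice.pickle (sample J x) = n]); last first.
  apply/seteqP; split=> x; first by exists (choice.pickle (sample J x)).
  by move=> [n _ []].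
apply: bigcupT_measurable => n.
have [[y [Py yn]]|no] := pselect (exists y, P y /\ choice.pickle (sample J y) = n).
  rewrite (_ : [set _ | _] = [set x | sample J x = sample J y]).
    exact: measurable_sample.
  apply/seteqP; split=> x /= => [[Px xn]|e].
    by apply: (pcan_inj choice.pickleK); rewrite xn.
  by rewrite e; split=> //; rewrite (hJ x y) //; exact: agree_sample.
rewrite (_ : [set _ | _] = set0) //; apply/seteqP; split=> // x h.
by apply: no; exists x.
Qed.

Definition tame (f : X -> R) := local f /\ exists M, forall x, `|f x| <= M.

Definition Ex (f : X -> R) : R := (\int[lam]_x f x)%R.

Lemma tame_measurable f : tame f -> measurable_fun setT f.
Proof.
move=> [lf _] _ B _; rewrite setTI; apply: local_measurable.
exact: (local_comp B lf).
Qed.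

Lemma tame_integrable f : tame f -> lam.-integrable setT (EFin \o f).
Proof.
move=> tf; apply: measurable_bounded_integrable => //.
- by rewrite [X in (X < _)%E]probability_setT ltry.
- exact: tame_measurable.
have [_ [M hM]] := tf; exists M; split; first exact: num_real.
by move=> M' MM' x _; exact: le_trans (hM x) (ltW MM').
Qed.

Lemma tame_cst r : tame (fun=> r).
Proof. by split; [exact: local_cst|exists `|r|]. Qed.

Lemma tameD f g : tame f -> tame g -> tame (fun x => f x + g x).
Proof.
move=> [lf [M hM]] [lg [M' hM']]; split; first exact: local_comp2.
by exists (M + M') => x; rewrite (le_trans (ler_normD _ _)) // lerD.
Qed.

Lemma tameM f g : tame f -> tame g -> tame (fun x => f x * g x).
Proof.
move=> [lf [M hM]] [lg [M' hM']]; split; first exact: local_comp2.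
by exists (M * M') => x; rewrite normrM ler_pM.
Qed.

Lemma tame_sum I (s : seq I) (P : pred I) (f : I -> X -> R) :
  (forall i, tame (f i)) -> tame (fun x => \sum_(i <- s | P i) f i x).
Proof.
move=> tf; elim: s => [|i s IHs].
  by under eq_fun do rewrite big_nil; exact: tame_cst.
under eq_fun do rewrite big_cons; case: (P i) => //; exact: tameD.
Qed.

Lemma tame_prop (P : X -> Prop) : local P -> tame (fun x => `[< P x >]%:R).
Proof.
move=> lP; split; first exact: (local_comp (fun P : Prop => `[<P>]%:R) lP).
by exists 1 => x; case: `[<_>]; rewrite ?normr1 ?normr0.
Qed.

Lemma tame_nat (f : X -> nat) n : local f -> (forall x, f x <= n)%N ->
  tame (fun x => (f x)%:R).
Proof.
move=> lf fn; split; first exact: (local_comp (fun n => n%:R) lf).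
by exists n%:R => x; rewrite normr_nat ler_nat.
Qed.

Lemma tame_act phi f : tame f -> tame (f \o act phi).
Proof.
by move=> [lf [M hM]]; split; [exact: local_act|exists M => x; exact: hM].
Qed.

Lemma Ex_cst r : Ex (fun=> r) = r.
Proof. by rewrite /Ex Rintegral_cst // [X in fine X]probability_setT mulr1. Qed.

Lemma ExD f g : tame f -> tame g -> Ex (fun x => f x + g x) = Ex f + Ex g.
Proof. by move=> tf tg; rewrite /Ex RintegralD //; exact: tame_integrable. Qed.

Lemma ExZ r f : tame f -> Ex (fun x => r * f x) = r * Ex f.
Proof. by move=> tf; rewrite /Ex RintegralZl //; exact: tame_integrable. Qed.

Lemma Ex_le f g : tame f -> tame g -> (forall x, f x <= g x) -> Ex f <= Ex g.
Proof. by move=> tf tg fg; apply: le_Rintegral => //; exact: tame_integrable. Qed.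

Lemma Ex_ge0 f : (forall x, 0 <= f x) -> 0 <= Ex f.
Proof. by move=> f0; apply: Rintegral_ge0. Qed.

Lemma Ex_sum I (s : seq I) (f : I -> X -> R) :
  (forall i, tame (f i)) ->
  Ex (fun x => \sum_(i <- s) f i x) = \sum_(i <- s) Ex (f i).
Proof.
move=> tf; elim: s => [|i s IHs].
  by rewrite big_nil -[RHS]Ex_cst; congr Ex; apply/funext => x; rewrite big_nil.
rewrite big_cons -IHs -ExD //; last exact: tame_sum.
by congr Ex; apply/funext => x; rewrite big_cons.
Qed.

Lemma Ex_prop (P : X -> Prop) : local P ->
  ((Ex (fun x => `[< P x >]%:R))%:E = lam [set x | P x])%E.
Proof.
move=> lP; have mP := local_measurable lP.
have fin : (lam [set x | P x] \is a fin_num)%E by exact: fin_num_measure.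
rewrite /Ex /Rintegral -[RHS]fineK //; congr (fine _)%:E.
by rewrite -[X in _ = lam X]setIT -(integral_indic _ measurableT mP).
Qed.

Lemma Ex_act phi f : tame f -> Ex (f \o act phi) = Ex f.
Proof.
move=> tf; rewrite /Ex /Rintegral; congr fine.
have pE : (\int[pushforward lam (act phi)]_x (EFin \o f) x =
           \int[lam]_x (EFin \o f) x)%E.
  apply: eq_measure_integral => A mA _; exact: act_measure.
rewrite -[RHS]pE integral_pushforward //.
  by have /measurable_int := tame_integrable tf.
by have := tame_integrable (tame_act phi tf).
Qed.

End Cube.

(** * Mass transport and invariant random labellings *)

Section Balls.
Variable Gamma : marked_group.
Notation E := (gens Gamma).
Notation ball := (graph_ball (@cay Gamma)).
Implicit Types (u v w g : Gamma).

Fixpoint ball_seq r : seq Gamma :=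
  if r is r'.+1
  then undup (ball_seq r' ++ [seq (a * g)%g | a <- enum_fset E, g <- ball_seq r'])
  else [:: 1%g].

Lemma ballS u r v :
  ball u r.+1 v <-> ball u r v \/ exists2 w, ball u r w & cay w v.
Proof.
split=> [[p [pp pl sp]]|[|[w uw wv]]].
- case/lastP: p pp pl sp => [_ <- _|p w]; first by left; exact: gball_refl.
  rewrite rcons_path last_rcons size_rcons => /andP[pp pw] <- sp.
  by right; exists (last u p) => //; exists p.
- exact: gball_le.
- by rewrite -addn1; apply: gball_trans uw _; exact: gball1.
Qed.

Lemma ball_seqP r v : reflect (ball 1%g r v) (v \in ball_seq r).
Proof.
apply: (iffP idP); elim: r v => [|r IHr] v /=.
- by rewrite inE => /eqP ->; exact: gball_refl.
- rewrite mem_undup mem_cat => /orP[/IHr h|/allpairsP[[a g] /= [aE /IHr h ->]]].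
    by apply/ballS; left.
  by apply/ballS; right; exists g => //; rewrite cayE mulgK.
- by move=> [[|? ?] [_ /= <-]] //; rewrite inE.
- move=> /ballS[/IHr h|[w /IHr h]]; rewrite mem_undup mem_cat; first by rewrite h.
  rewrite cayE => vw; apply/orP; right; apply/allpairsP.
  by exists ((v * w^-1)%g, w); rewrite /= mulgVK.
Qed.

Lemma ball_seq_uniq r : uniq (ball_seq r).
Proof. by case: r => [|r] //=; exact: undup_uniq. Qed.

Lemma ball_seq1 r : 1%g \in ball_seq r.
Proof. apply/ball_seqP; exact: gball_refl. Qed.

Lemma rtrans_adj g u v : cay (u * g)%g (v * g)%g = cay u v.
Proof. by rewrite !cayE invgM mulgA mulgK. Qed.

Definition rtrans g : cay_aut Gamma :=
  @CayAut Gamma (fun u => (u * g)%g) (fun u => (u * g^-1)%g)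
          (fun u => mulgK g u) (fun u => mulgVK g u) (rtrans_adj g).

Lemma ball_rtrans u r v : ball u r v <-> (v * u^-1)%g \in ball_seq r.
Proof.
rewrite -(ball_move (rtrans u^-1)) /= mulgV.
by split=> [h|/ball_seqP//]; apply/ball_seqP.
Qed.

Lemma ball_seq_inv r g : (g^-1%g \in ball_seq r) = (g \in ball_seq r).
Proof.
have h u : u \in ball_seq r -> u^-1%g \in ball_seq r.
  move=> /ball_seqP h; rewrite -[u^-1%g]mul1g; apply/ball_rtrans.
  exact: gball_sym (@cay_sym Gamma) h.
by apply/idP/idP => /h //; rewrite invgK.
Qed.

Lemma big_ball_inv (T : nmodType) r (f : Gamma -> T) :
  \sum_(g <- ball_seq r) f g^-1%g = \sum_(g <- ball_seq r) f g.
Proof.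
rewrite -(big_map (fun g : Gamma => g^-1%g) xpredT f); apply: perm_big.
apply: uniq_perm; [|exact: ball_seq_uniq|].
  by rewrite map_inj_uniq; [exact: ball_seq_uniq|exact: invg_inj].
move=> g; apply/mapP/idP => [[h hr ->]|gr]; first by rewrite ball_seq_inv.
by exists g^-1%g; rewrite ?ball_seq_inv // invgK.
Qed.

End Balls.

Lemma count_le1 (T : eqType) (P : pred T) s : uniq s ->
  {in s &, forall x y, P x -> P y -> x = y} -> (count P s <= 1)%N.
Proof.
move=> us inj; rewrite -size_filter.
have := filter_uniq P us.
case e : (seq.filter P s) => [|x [|y t]] //=.
have xs : x \in seq.filter P s by rewrite e inE eqxx.
have ys : y \in seq.filter P s by rewrite e !inE eqxx orbT.
move: xs ys; rewrite !mem_filter => /andP[Px xs] /andP[Py ys].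
by rewrite (inj x y) // inE eqxx.
Qed.

Section MassTransport.
Variables (R : realType) (Gamma : marked_group).
Notation X := (cube R Gamma).
Variable lam : probability X R.
Hypothesis lamP : is_lebesgue_power lam.
Notation Ex := (Ex lam).

Lemma act_rtrans_inv (f : X -> Gamma -> Gamma -> R) :
  (forall g x u v, f (act (rtrans g) x) (u * g)%g (v * g)%g = f x u v) ->
  forall x g, f x 1%g g = f (act (rtrans g^-1%g) x) g^-1%g 1%g.
Proof.
by move=> fE x g; rewrite -(fE g^-1%g) mul1g mulgV.
Qed.

(** The expected mass sent by the root to [g] is the expected mass sent by [g^-1]
    to the root. *)
Lemma mass_transport (F : X -> Gamma -> Gamma -> R) r :
  (forall u v, tame (fun x => F x u v)) ->
  (forall g x u v, F (act (rtrans g) x) (u * g)%g (v * g)%g = F x u v) ->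
  Ex (fun x => \sum_(g <- ball_seq Gamma r) F x 1%g g) =
  Ex (fun x => \sum_(g <- ball_seq Gamma r) F x g 1%g).
Proof.
move=> tF eF; rewrite !Ex_sum // -[RHS]big_ball_inv.
apply: eq_bigr => g _; rewrite -(Ex_act lamP (rtrans g^-1%g) (tF g^-1%g 1%g)).
by congr Ex; apply/funext => x; exact: act_rtrans_inv.
Qed.

Lemma Ex_translate (f : X -> Gamma -> R) g :
  (forall u, tame (f ^~ u)) ->
  (forall g x u, f (act (rtrans g) x) (u * g)%g = f x u) ->
  Ex (f ^~ g) = Ex (f ^~ 1%g).
Proof.
move=> tf ef; rewrite -(Ex_act lamP (rtrans g) (tf g)); congr Ex.
by apply/funext => x /=; rewrite -(ef g x) mul1g.
Qed.

End MassTransport.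

Section RandomLabelling.
Variables (R : realType) (Gamma : marked_group).
Notation E := (gens Gamma).
Notation X := (cube R Gamma).
Notation ball := (graph_ball (@cay Gamma)).
Notation B := (ball_seq Gamma).
Implicit Types (c : X -> partial_labelling Gamma).

Record fiid_partial c := FiidPartial {
  fiid_coherent : forall x, coherent (c x) ;
  fiid_local : forall u v, local (fun x => c x u v) ;
  fiid_move : forall phi x, c (act phi x) = move phi (c x)
}.

Arguments fiid_coherent {c} _ x.

Definition cell N (x : X) (v : Gamma) : 'I_N.+2 := disc N (x v)%:num.

Lemma act_rev phi (x : X) : act (aut_rev phi) (act phi x) = x.
Proof. by apply/funext => v; rewrite /act /act_vertex /= aut_funK. Qed.

(** For the converse, apply the hypothesis to the inverse automorphism. *)
Lemma equivariant_iff (P : X -> Gamma -> Gamma -> Prop) :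
  (forall phi x u v, P x u v -> P (act phi x) (phi u) (phi v)) ->
  forall phi x u v, P (act phi x) (phi u) (phi v) <-> P x u v.
Proof.
move=> h phi x u v; split; last exact: h.
by move/(h (aut_rev phi)); rewrite act_rev /= !aut_funK.
Qed.

Lemma local_cell N v : local (fun x => cell N x v).
Proof. by exists [:: (v, N)] => x y /(_ (v, N) (mem_head _ _)). Qed.

Lemma fiid_agree c N (s : seq Gamma) : fiid_partial c -> exists J, forall x y,
  agree J x y ->
  (forall v, v \in s -> cell N x v = cell N y v) /\
  (forall v w, v \in s -> w \in s -> c x v w = c y v w).
Proof.
move=> fc.
have [J hJ] := @local_all R Gamma _ _ s (fun v x => cell N x v)
  (fun v => local_cell N v).
have [J' hJ'] := @local_all R Gamma _ _ (allpairs pair s s)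
  (fun vw x => c x vw.1 vw.2) (fun vw => fiid_local fc vw.1 vw.2).
exists (J ++ J') => x y /agree_cat[h h']; split; first exact: hJ.
move=> v w vs ws; apply: (hJ' x y h' (v, w)); exact: allpairs_f.
Qed.

Definition ball_at u r : seq Gamma := [seq (g * u)%g | g <- B r].

Lemma ball_atP u r v : ball u r v -> v \in ball_at u r.
Proof.
move/ball_rtrans => h; apply/mapP; exists (v * u^-1)%g => //.
by rewrite mulgVK.
Qed.

(** What depends on the colours and the labels inside a ball depends on finitely
    many discretised coordinates, because the balls are finite and each label
    depends on finitely many of them. *)
Lemma fiid_local_ball c N r u T (f : X -> T) : fiid_partial c ->
  (forall x y,
    (forall v, ball u r v -> cell N x v = cell N y v) ->
    (forall v, ball u r v -> c x v = c y v) -> f x = f y) ->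
  local f.
Proof.
move=> fc fP; have [J hJ] := fiid_agree N (ball_at u r.+1) fc.
exists J => x y /hJ[h1 h2]; apply: fP => v uv.
  by apply: h1; apply: ball_atP; exact: gball_le uv.
apply/funext => w; have [vw|vw] := boolP (cay v w).
  apply: h2; apply: ball_atP; first exact: gball_le uv.
  by apply/ballS; right; exists v.
have no z : c z v w = None.
  case e : (c z v w) => [a|] //.
  by have [] := fiid_coherent fc z _ _ _ e; rewrite (negbTE vw).
by rewrite !no.
Qed.

Section Step.
Variables (N r : nat) (D : round_code Gamma 'I_N.+2).

Definition random_round c x := round r (cell N x) D (c x).

Lemma fiid_round c : fiid_partial c -> fiid_partial (random_round c).
Proof.
move=> fc; split.
- by move=> x; apply: round_coherent; exact: fiid_coherent.
- move=> u v; apply: (@fiid_local_ball _ N (2 * r).+1 u _ _ fc) => x y h1 h2.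
  apply: round_local => //.
    by move=> w z uw _; rewrite h2 //; apply: gball_le uw; lia.
  by rewrite h2 //; exact: gball_refl.
- move=> phi x; rewrite /random_round (fiid_move fc) -round_move //.
Qed.

Definition companions c x u v := exists S,
  [/\ repairable r (cell N x) D (c x) S, u \in S & v \in S].

Lemma local_companions c u v : fiid_partial c -> local (fun x => companions c x u v).
Proof.
move=> fc; apply: (@fiid_local_ball _ N (3 * r).+1 u _ _ fc) => x y.
suff h x' y' : (forall v, ball u (3 * r).+1 v -> cell N x' v = cell N y' v) ->
    (forall v, ball u (3 * r).+1 v -> c x' v = c y' v) ->
    companions c x' u v -> companions c y' u v.
  by move=> h1 h2; apply/propext; split; apply: h => // w uw; apply/esym; auto.
move=> {x y} h1 h2 [S [[[s1 s2] s3 rep] uS vS]]; exists S; split=> //.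
have hS w : w \in S -> cell N y' w = cell N x' w.
  by move=> wS; rewrite h1 //; apply: gball_le (s1 _ _ uS wS); lia.
split; first split => //.
- move=> w wS z t wz wt; rewrite -(h1 z) -?(h1 t); first exact: (s2 w).
    by apply: gball_le (gball_trans (s1 _ _ uS wS) wt); lia.
  by apply: gball_le (gball_trans (s1 _ _ uS wS) wz); lia.
- by move=> k; rewrite s3; split=> -[w wS <-]; exists w => //; rewrite hS.
- apply: eq_repair rep => w z wS.
    by move=> _; rewrite h2 //; apply: gball_le (s1 _ _ uS wS); lia.
  rewrite /decoded; have [wz|//] := boolP (cay w z).
  rewrite hS // -(h1 z) //.
  apply: gball_le (gball_trans (s1 _ _ uS wS) (gball1 0 wz)); lia.
Qed.

Lemma companions_move c : fiid_partial c -> forall phi x u v,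
  companions c (act phi x) (phi u) (phi v) <-> companions c x u v.
Proof.
move=> fc; apply: equivariant_iff => phi x u v [S [SP uS vS]].
exists [fset phi w | w in S]%fset; split.
- rewrite (fiid_move fc); apply: repairable_move SP.
    by move=> w; rewrite /cell /act /act_vertex /= aut_funK.
  by move=> w z; rewrite /move !aut_funK.
- by rewrite mem_imfset //; exact: aut_inj.
- by rewrite mem_imfset //; exact: aut_inj.
Qed.

End Step.

Lemma local_deficit c u : fiid_partial c -> local (fun x => deficit (c x) u).
Proof.
move=> fc; apply: (@fiid_local_ball _ 0 0 u _ _ fc) => x y _ h.
by apply: eq_deficit => v _; rewrite h //; exact: gball_refl.
Qed.

Lemma deficit_le c u x : (deficit (c x) u <= #|{: E}|)%N.
Proof. exact: max_card. Qed.

Lemma tame_deficit c u : fiid_partial c -> tame (fun x => (deficit (c x) u)%:R : R).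
Proof.
move=> fc; apply: tame_nat (local_deficit u fc) _ => x; exact: deficit_le.
Qed.

Lemma fiid_deficit_move c phi x u : fiid_partial c ->
  deficit (c (act phi x)) (phi u) = deficit (c x) u.
Proof.
by move=> fc; apply: deficit_move => v w; rewrite (fiid_move fc) /move !aut_funK.
Qed.

End RandomLabelling.

Arguments fiid_coherent {R Gamma c} _ x.

(** * Long chains *)

Section Chains.
Variable Gamma : marked_group.
Notation E := (gens Gamma).
Notation ball := (graph_ball (@cay Gamma)).
Implicit Types (c : partial_labelling Gamma) (u v w : Gamma) (p q : E).

Lemma chain_iterS c p q k u :
  chain_iter c p q k.+1 u = obind (chain_step c p q) (chain_iter c p q k u).
Proof. by []. Qed.

Lemma chain_step_inj c p q u u' w : coherent c ->
  chain_step c p q u = Some w -> chain_step c p q u' = Some w -> u = u'.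
Proof.
move=> cc /(chain_stepP _ _ _ _ cc)[y uy wy] /(chain_stepP _ _ _ _ cc)[y' u'y' wy'].
have [_ _ /(_ _ wy') yy'] := cc _ _ _ wy; subst y'.
have [_ yu _] := cc _ _ _ uy; have [_ yu' _] := cc _ _ _ u'y'.
by have [_ _ /(_ _ yu) ->] := cc _ _ _ yu'.
Qed.

(** The chain can be followed backwards without choice, up to the vertex that
    misses [q], which must be its start. *)
Lemma chain_iter_inj c p q i j u u' w : coherent c ->
  ~~ has_label c u q -> ~~ has_label c u' q ->
  chain_iter c p q i u = Some w -> chain_iter c p q j u' = Some w ->
  i = j /\ u = u'.
Proof.
move=> cc uq u'q; elim: i j w => [|i IHi] [|j] w.
- by move=> [<-] [<-].
- move=> [uw]; rewrite chain_iterS; case: (chain_iter _ _ _ j _) => [z|] //=.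
  move=> /(chain_stepP _ _ _ _ cc)[y _ wy]; case/negP: uq.
  by apply/has_labelP => //; exists y; rewrite uw.
- rewrite chain_iterS; case: (chain_iter _ _ _ i _) => [z|] //=.
  move=> /(chain_stepP _ _ _ _ cc)[y _ wy] [u'w]; case/negP: u'q.
  by apply/has_labelP => //; exists y; rewrite u'w.
rewrite !chain_iterS; case iz : (chain_iter _ _ _ i _) => [z|] //= zw.
case jz : (chain_iter _ _ _ j _) => [z'|] //= z'w.
have zz' := chain_step_inj cc zw z'w; subst z'.
by have [-> ->] := IHi _ _ iz jz.
Qed.

Lemma chain_iter_prefix c p q i j u : (i <= j)%N ->
  chain_iter c p q j u != None -> chain_iter c p q i u != None.
Proof.
move=> ij; rewrite -(subnK ij); elim: (j - i)%N => [|k IHk] //.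
rewrite addSn chain_iterS; case e : (chain_iter _ _ _ (k + i) _) => [z|] // _.
by apply: IHk; rewrite e.
Qed.

Lemma nbr_row c c' u p : c u = c' u -> nbr c u p = nbr c' u p.
Proof. by rewrite /nbr => ->. Qed.

Lemma chain_iter_row c c' p q k u : coherent c ->
  (forall v, ball u (2 * k) v -> c v = c' v) ->
  chain_iter c p q k u = chain_iter c' p q k u.
Proof.
move=> cc; elim: k => // k IHk h.
rewrite !chain_iterS -IHk; last first.
  by move=> v uv; apply: h; apply: gball_le uv; lia.
case e : (chain_iter c p q k u) => [w|] //=.
have uw := chain_iter_ball cc e.
rewrite /chain_step -(nbr_row p (h w _)); last by apply: gball_le uw; lia.
case e' : (nbr c w p) => [y|] //=.
apply/nbr_row/h; have /(nbrP _ _ _ cc)/cc[wy _ _] := e'.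
apply: gball_le (gball_trans uw (gball1 0 wy)); lia.
Qed.

Lemma has_label_row c c' u p : c u = c' u -> has_label c u p = has_label c' u p.
Proof. by rewrite /has_label => ->. Qed.

Lemma has_label_move (phi : cay_aut Gamma) c u p :
  has_label (move phi c) (phi u) p = has_label c u p.
Proof.
apply/idP/idP; apply: eq_has_label => v uv.
  exists (aut_inv phi v); first by rewrite -(aut_adj phi) aut_invK.
  by rewrite /move aut_funK.
by exists (phi v); rewrite ?aut_adj // /move !aut_funK.
Qed.

Lemma coherent_move (phi : cay_aut Gamma) c : coherent c -> coherent (move phi c).
Proof.
move=> cc u v a /cc[uv vu inj]; split=> //.
  by rewrite -(aut_inv_adj phi).
by move=> w /inj /(can_inj (@aut_invK _ phi)).
Qed.

Lemma nbr_move (phi : cay_aut Gamma) c u p : coherent c ->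
  nbr (move phi c) (phi u) p = omap phi (nbr c u p).
Proof.
move=> cc; have cm : coherent (move phi c) by exact: coherent_move.
case e : (nbr c u p) => [v|] /=.
  by apply/nbrP => //; move/(nbrP _ _ _ cc): e; rewrite /move !aut_funK.
case e' : (nbr _ _ _) => [v|] //; move/(nbrP _ _ _ cm): e'.
by rewrite /move aut_funK => /(nbrP _ _ _ cc); rewrite e.
Qed.

Lemma chain_iter_move (phi : cay_aut Gamma) c p q k u : coherent c ->
  chain_iter (move phi c) p q k (phi u) = omap phi (chain_iter c p q k u).
Proof.
move=> cc; elim: k => // k IHk; rewrite !chain_iterS IHk.
case: (chain_iter c p q k u) => [w|] //=; rewrite /chain_step nbr_move //.
by case: (nbr c w p) => [y|] //=; rewrite nbr_move.
Qed.

End Chains.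

Lemma natr_count (R : pzSemiRingType) (T : Type) (P : pred T) s :
  (count P s)%:R = \sum_(i <- s) (P i)%:R :> R.
Proof.
rewrite -sum1_count big_mkcond natr_sum; apply: eq_bigr => i _.
by case: (P i).
Qed.

Section Estimates.
Variables (R : realType) (Gamma : marked_group).
Notation E := (gens Gamma).
Notation X := (cube R Gamma).
Notation ball := (graph_ball (@cay Gamma)).
Notation B := (ball_seq Gamma).
Variable lam : probability X R.
Hypothesis lamP : is_lebesgue_power lam.
Notation Ex := (Ex lam).
Implicit Types (c : X -> partial_labelling Gamma).

Definition Pr (P : X -> Prop) : R := Ex (fun x => `[< P x >]%:R).

Lemma Pr_le_Ex (P : X -> Prop) f : local P -> tame f ->
  (forall x, 0 <= f x) -> (forall x, P x -> 1 <= f x) -> Pr P <= Ex f.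
Proof.
move=> lP tf f0 f1; apply: Ex_le => //; first exact: tame_prop.
by move=> x; case: asboolP => // h; exact: f1.
Qed.

Definition long_chain p q k c x u :=
  ~~ has_label (c x) u q && (chain_iter (c x) p q k u != None).

Lemma local_long_chain p q k c u : fiid_partial c ->
  local (fun x => long_chain p q k c x u).
Proof.
move=> fc; apply: (@fiid_local_ball _ _ _ 0 (2 * k) u _ _ fc) => x y _ h.
rewrite /long_chain (has_label_row q (h u (gball_refl _ _ _))).
by rewrite (@chain_iter_row _ _ (c y)) //; exact: fiid_coherent.
Qed.

Lemma long_chain_move p q k c phi x u : fiid_partial c ->
  long_chain p q k c (act phi x) (phi u) = long_chain p q k c x u.
Proof.
move=> fc; have cx := fiid_coherent fc x.
rewrite /long_chain (fiid_move fc) has_label_move chain_iter_move //.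
by case: (chain_iter _ _ _ _ _).
Qed.

(** Let the start of every long chain send mass 1 to each of its first [k+1]
    even vertices.  A vertex receives mass at most 1, because it determines the
    start of the chain and its own rank in it. *)
Lemma Pr_long_chain p q k c : fiid_partial c ->
  Pr (fun x => long_chain p q k c x 1%g) <= k.+1%:R^-1.
Proof.
move=> fc.
pose F x u v : R := \sum_(j < k.+1)
  (long_chain p q k c x u && (chain_iter (c x) p q j u == Some v))%:R.
have tF u v : tame (fun x => F x u v).
  apply: tame_sum => j; apply: (@tame_nat _ _ _ 1); last by move=> x; case: (_ && _).
  apply: (@local_comp2 _ _ _ _ _ _ _ (fun b o => (b && (o == Some v) : nat)
     ) (local_long_chain p q k u fc)).
  apply: (@fiid_local_ball _ _ _ 0 (2 * j) u _ _ fc) => x y _ h.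
  by rewrite (@chain_iter_row _ _ (c y)) //; exact: fiid_coherent.
have eF phi x u v : F (act phi x) (phi u) (phi v) = F x u v.
  apply: eq_bigr => j _; rewrite long_chain_move // (fiid_move fc).
  rewrite chain_iter_move; last exact: fiid_coherent.
  case: (chain_iter _ _ _ j u) => [w|] //=.
  by rewrite !(inj_eq Some_inj) (inj_eq (@aut_inj _ phi)).
have := mass_transport lamP (2 * k) tF (fun g x u v => eF (rtrans g) x u v).
rewrite (_ : (fun x => _) = fun x => k.+1%:R * `[< long_chain p q k c x 1%g >]%:R); last first.
  apply/funext => x; rewrite /F exchange_big /= asboolb.
  have [lc|_] := boolP (long_chain _ _ _ _ _ _); last first.
    by rewrite mulr0 big1 // => j _; rewrite big1.
  rewrite mulr1 -[in RHS](card_ord k.+1) -sum1_card natr_sum; apply: eq_bigr => j _.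
  have /andP[_ /(chain_iter_prefix (ltnSE (ltn_ord j)))] := lc.
  case e : (chain_iter _ _ _ j _) => [w|] // _.
  have wB : w \in B (2 * k).
    apply/ball_seqP; apply: gball_le (chain_iter_ball (fiid_coherent fc x) e).
    by have := ltn_ord j; lia.
  rewrite (bigD1_seq w) //=; last exact: ball_seq_uniq.
  rewrite eqxx /= big1 ?addr0 // => v; rewrite eq_sym => /negbTE vw.
  by rewrite (inj_eq Some_inj) vw.
rewrite ExZ; last by apply: tame_prop; apply: local_comp (local_long_chain p q k 1%g fc).
rewrite -/(Pr _) => e.
rewrite -[X in _ <= X]mul1r ler_pdivlMr ?ltr0n // mulrC e.
rewrite -[X in _ <= X](Ex_cst lam); apply: Ex_le.
- exact: tame_sum.
- exact: tame_cst.
move=> x.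
pose s := [seq (u, j) | u <- B (2 * k), j <- enum 'I_k.+1].
pose P (uj : Gamma * 'I_k.+1) :=
  long_chain p q k c x uj.1 && (chain_iter (c x) p q uj.2 uj.1 == Some 1%g).
rewrite (_ : \sum_(u <- _) _ = (count P s)%:R).
  rewrite -[X in _ <= X]/(1%:R) ler_nat; apply: count_le1.
    apply: allpairs_uniq => [||[? ?] [? ?] _ _ [-> ->]] //; first exact: ball_seq_uniq.
    exact: enum_uniq.
  move=> [u i] [u' j] _ _ /andP[/andP[/= uq _] /eqP ui] /andP[/andP[/= u'q _] /eqP u'j].
  have [ij ->] := chain_iter_inj (fiid_coherent fc x) uq u'q ui u'j.
  by congr pair; exact: val_inj.
rewrite natr_count /s big_allpairs /=.
apply: eq_bigr => u _; rewrite /F big_enum /=; exact: eq_bigr.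
Qed.

End Estimates.

(** * The gain of a pass *)

Lemma card_repairable (Gamma : marked_group) (K : finType) r (d : Gamma -> K) D c
    (S : {fset Gamma}) : repairable r d D c S -> #|` S| = #|D.1|.
Proof.
move=> [[s1 s2] s3 _].
rewrite cardfE -(card_in_imset (f := fun u : S => d (val u))); last first.
  move=> u v _ _ duv; apply: val_inj; apply: (s2 (val u)) => //.
  - exact: valP.
  - exact: gball_refl.
  - by apply: s1; exact: valP.
apply: eq_card => k; apply/finset.imsetP/idP => [[u _ ->]|/s3[u uS <-]].
  by apply/s3; exists (val u) => //; exact: valP.
by exists [` uS]%fset.
Qed.

Lemma repairable_card_le (Gamma : marked_group) (K : finType) r (d : Gamma -> K) D c
    (S : {fset Gamma}) u : repairable r d D c S -> u \in S ->
  (#|` S| <= size (ball_seq Gamma r))%N.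
Proof.
move=> [[s1 _] _ _] uS.
rewrite -(size_map (fun v => v * u^-1)%g); apply: uniq_leq_size.
  by rewrite map_inj_uniq ?fset_uniq //; exact: mulIg.
move=> _ /mapP[v vS ->]; exact/ball_rtrans/s1.
Qed.

Lemma big_seq_fset (T : nmodType) (I : choiceType) (s : seq I) (S : {fset I}) (f : I -> T) :
  uniq s -> {subset S <= s} -> \sum_(i <- s | i \in S) f i = \sum_(i <- S) f i.
Proof.
move=> us Ss; rewrite -big_filter; apply: perm_big; apply: uniq_perm.
- exact: filter_uniq.
- exact: fset_uniq.
by move=> i; rewrite mem_filter andb_idr // => /Ss.
Qed.

Section RoundEstimates.
Variables (R : realType) (Gamma : marked_group).
Notation E := (gens Gamma).
Notation X := (cube R Gamma).
Notation ball := (graph_ball (@cay Gamma)).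
Notation B := (ball_seq Gamma).
Variable lam : probability X R.
Hypothesis lamP : is_lebesgue_power lam.
Notation Ex := (Ex lam).
Notation Pr := (Pr lam).
Implicit Types (c : X -> partial_labelling Gamma).

Definition mean_deficit c : R := Ex (fun x => (deficit (c x) 1%g)%:R).

Section Round.
Variables (N r : nat) (D : round_code Gamma 'I_N.+2).
Variables (c : X -> partial_labelling Gamma).
Hypothesis fc : fiid_partial c.
Let c' := random_round r D c.
Let fc' : fiid_partial c' := fiid_round r D fc.

Lemma activeP x u : active r (cell N x) D (c x) u <-> companions r D c x u u.
Proof. by split=> [[S SP uS]|[S [SP uS _]]]; exists S. Qed.

Lemma local_active u : local (fun x => active r (cell N x) D (c x) u).
Proof.
have [J hJ] := local_companions r D u u fc; exists J => x y /hJ h.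
by rewrite (propext (activeP x u)) (propext (activeP y u)).
Qed.

Lemma Pr_active u : Pr (fun x => active r (cell N x) D (c x) u) =
                    Pr (fun x => active r (cell N x) D (c x) 1%g).
Proof.
apply: (Ex_translate lamP
  (f := fun x u => `[< active r (cell N x) D (c x) u >]%:R)).
  by move=> v; apply: tame_prop; exact: local_active.
move=> g x v; congr (nat_of_bool _)%:R; apply/asbool_equiv_eq.
rewrite !activeP; exact: (companions_move r D fc (rtrans g)).
Qed.

(** Let every vertex [u] of a repair receive the gain at [v] for each [v] in the
    same repair.  An active vertex receives at least 1, and the mass sent by a
    vertex is its own gain times the size of the repair.  That size is prescribed by
    the code and bounded by the size of a ball. *)
Lemma round_estimate :
  Pr (fun x => active r (cell N x) D (c x) 1%g) <=
  (size (B r))%:R * (mean_deficit c - mean_deficit c').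
Proof.
pose gain x v : R := (deficit (c x) v)%:R - (deficit (c' x) v)%:R.
have tgain v : tame (fun x => gain x v).
  apply: tameD; first exact: tame_deficit.
  rewrite (_ : (fun x => _) = fun x => -1 * (deficit (c' x) v)%:R).
    by apply: tameM; [exact: tame_cst|exact: tame_deficit].
  by apply/funext => x; rewrite mulN1r.
have Egain : Ex (gain^~ 1%g) = mean_deficit c - mean_deficit c'.
  rewrite (_ : gain^~ 1%g = fun x => (deficit (c x) 1%g)%:R + -1 * (deficit (c' x) 1%g)%:R).
    rewrite ExD ?ExZ ?mulN1r //; try exact: tame_deficit.
    by apply: tameM; [exact: tame_cst|exact: tame_deficit].
  by apply/funext => x; rewrite mulN1r.
(* The mass that [u] receives from [v]. *)
pose F x u v : R := `[< companions r D c x u v >]%:R * gain x v.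
have tF u v : tame (fun x => F x u v).
  by apply: tameM => //; apply: tame_prop; exact: local_companions.
have eF g x u v : F (act (rtrans g) x) (u * g)%g (v * g)%g = F x u v.
  rewrite /F /gain (fiid_deficit_move (rtrans g) x v fc).
  rewrite (fiid_deficit_move (rtrans g) x v fc'); congr (_%:R * _).
  by congr nat_of_bool; apply/asbool_equiv_eq; exact: (companions_move r D fc (rtrans g)).
have compS x S u v : repairable r (cell N x) D (c x) S -> u \in S ->
    companions r D c x u v <-> v \in S.
  move=> SP uS; split=> [[S' [SP' uS' vS']]|vS]; last by exists S.
  by rewrite (repairable_eq SP SP' uS uS').
have SB x S : repairable r (cell N x) D (c x) S -> 1%g \in S -> {subset S <= B r}.
  by move=> [[s1 _] _ _] S1 v vS; apply/ball_seqP; exact: s1.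
have compC x u v : companions r D c x u v -> companions r D c x v u.
  by move=> [S [? ? ?]]; exists S.
have Fsum x S : repairable r (cell N x) D (c x) S -> 1%g \in S ->
    \sum_(v <- B r) F x 1%g v = \sum_(v <- S) gain x v.
  move=> SP S1; rewrite -(big_seq_fset _ (ball_seq_uniq _ r) (SB _ _ SP S1)).
  rewrite [RHS]big_mkcond; apply: eq_bigr => v _; rewrite /F.
  rewrite (asbool_equiv_eq (compS _ _ _ v SP S1)) asboolb.
  by case: (v \in S); rewrite ?mul1r ?mul0r.
have sent x : \sum_(u <- B r) F x u 1%g = #|D.1|%:R * gain x 1%g.
  have [[S SP S1]|nA] := pselect (active r (cell N x) D (c x) 1%g).
    rewrite -(card_repairable SP) -sum1_size natr_sum mulr_suml.
    rewrite -(big_seq_fset _ (ball_seq_uniq _ r) (SB _ _ SP S1)).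
    rewrite [RHS]big_mkcond; apply: eq_bigr => v _; rewrite /F.
    rewrite -(asboolb (v \in S)) -(asbool_equiv_eq (compS _ _ _ v SP S1)).
    rewrite (_ : `[< companions r D c x v 1%g >] = `[< companions r D c x 1%g v >]).
      by case: `[< _ >]; rewrite ?mul0r.
    by apply/asbool_equiv_eq; split; exact: compC.
  rewrite /gain /c' round_deficit_inactive // subrr mulr0 big1 // => u _.
  rewrite /F asboolF ?mul0r // => -[S [SP uS S1]]; apply: nA; by exists S.
(* By [round_deficit_lt] the gains over a repair add up to a positive integer. *)
have received x : (`[< active r (cell N x) D (c x) 1%g >])%:R <= \sum_(v <- B r) F x 1%g v.
  case: asboolP => [[S SP S1]|nA].
    rewrite (Fsum _ _ SP S1) big_split /= sumrN -!natr_sum.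
    rewrite lerBrDr -natrD ler_nat add1n; exact: round_deficit_lt SP.
  rewrite big1 // => v _; rewrite /F asboolF ?mul0r // => -[S [SP S1 _]].
  by apply: nA; exists S.
have le1 : Pr (fun x => active r (cell N x) D (c x) 1%g) <= #|D.1|%:R * Ex (gain^~ 1%g).
  rewrite -ExZ //.
  rewrite (_ : (fun x => _ * _) = fun x => \sum_(u <- B r) F x u 1%g); last first.
    by apply/funext => x; rewrite sent.
  rewrite -(mass_transport lamP r tF eF); apply: Ex_le => //.
    by apply: tame_prop; exact: local_active.
  exact: tame_sum.
rewrite -Egain.
have [[x [S SP S1]]|nA] := pselect (exists x, active r (cell N x) D (c x) 1%g).
  have P0 : 0 <= Pr (fun x => active r (cell N x) D (c x) 1%g).
    by apply: Ex_ge0 => y; rewrite ler0n.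
  have D0 : (0 < #|D.1|)%N.
    by rewrite -(card_repairable SP) cardfs_gt0; apply/fset0Pn; exists 1%g.
  have G0 : 0 <= Ex (gain^~ 1%g).
    by have := le_trans P0 le1; rewrite pmulr_rge0 // ltr0n.
  apply: le_trans le1 _; rewrite ler_wpM2r // ler_nat -(card_repairable SP).
  exact: repairable_card_le SP S1.
rewrite (_ : gain^~ 1%g = fun=> 0); last first.
  apply/funext => x; rewrite /gain /c' round_deficit_inactive ?subrr //.
  by move=> A; apply: nA; exists x.
rewrite Ex_cst mulr0 /Pr (_ : (fun x => _) = fun=> 0) ?Ex_cst //.
by apply/funext => x; rewrite asboolF // => A; apply: nA; exists x.
Qed.

End Round.

Section Pass.
Variables (N r : nat).

Definition random_rounds c (l : seq (round_code Gamma 'I_N.+2)) x :=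
  rounds r (cell N x) (c x) l.

(** The function [T] counts the active vertices near the root over all rounds;
    its expectation is the sum of the estimates of the rounds, which
    telescopes. *)
Lemma pass_estimate l c : fiid_partial c ->
  fiid_partial (random_rounds c l) /\ exists T : X -> R,
  [/\ tame T, forall x, 0 <= T x,
      Ex T <= (size (B r))%:R ^+ 2 * (mean_deficit c - mean_deficit (random_rounds c l)) &
      forall x l1 D l2 u, l = l1 ++ D :: l2 -> ball 1%g r u ->
        active r (cell N x) D (random_rounds c l1 x) u -> 1 <= T x].
Proof.
elim: l c => [|D0 l IHl] c fc.
  split=> //; exists (fun=> 0); split=> //; first exact: tame_cst.
    by rewrite Ex_cst subrr mulr0.
  by move=> x [|? ?].
have [fc' [T [tT T0 ET T1]]] := IHl _ (fiid_round r D0 fc).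
split; first exact: fc'.
pose A u x : R := `[< active r (cell N x) D0 (c x) u >]%:R.
have tA u : tame (A u) by apply: tame_prop; exact: local_active.
exists (fun x => \sum_(u <- B r) A u x + T x); split.
- by apply: tameD => //; exact: tame_sum.
- by move=> x; rewrite addr_ge0 // sumr_ge0 // => u _; rewrite ler0n.
- rewrite ExD //; last exact: tame_sum.
  rewrite Ex_sum // (eq_bigr (fun=> Pr (fun x => active r (cell N x) D0 (c x) 1%g))); last first.
    by move=> u _; exact: Pr_active.
  rewrite big_const_seq iter_addr addr0 count_predT -[_ *+ _]mulr_natl.
  have := round_estimate r D0 fc; set P := Pr _ => hP.
  apply: le_trans (lerD (ler_wpM2l _ hP) ET) _; first exact: ler0n.
  by rewrite mulrA -expr2 -mulrDr ler_wpM2l ?exprn_ge0 // addrA subrK.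
- move=> x [|D1 l1] D l2 u [eD el] uB uA.
    rewrite (le_trans (_ : 1 <= A u x)) //; first by rewrite /A eD asboolT.
    rewrite (bigD1_seq u) /=; [|exact/ball_seqP|exact: ball_seq_uniq].
    by rewrite -addrA lerDl addr_ge0 // sumr_ge0 // => v _; rewrite ler0n.
  rewrite -eD in uA; rewrite (le_trans (T1 x l1 D l2 u el uB uA)) // lerDr.
  by rewrite sumr_ge0 // => v _; rewrite ler0n.
Qed.

(** If a repair is possible at the root before the pass, some vertex near the
    root is active in one of the rounds. *)
Lemma pass c : fiid_partial c -> (0 < r)%N -> exists2 c', fiid_partial c' &
  forall Q : X -> Prop, local Q ->
  (forall x, Q x -> exists (S : {fset Gamma}) t,
     [/\ repair (c x) S t, well_separated r (cell N x) S & 1%g \in S]) ->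
  Pr Q <= (size (B r))%:R ^+ 2 * (mean_deficit c - mean_deficit c').
Proof.
move=> fc r0; pose l := enum {: round_code Gamma 'I_N.+2}.
have [fc' [T [tT T0 ET T1]]] := pass_estimate l fc.
exists (random_rounds c l) => // Q lQ hQ.
apply: le_trans ET; apply: Pr_le_Ex => // x /hQ[S [t [rep sep S1]]].
have [D SD] := repair_code r0 sep rep.
have [||l1 [D' [l2 [u [lE uS uA]]]]] := @repair_touched _ _ r (cell N x) (c x) S t l D _ SD.
- by exists 1%g.
- by rewrite /l mem_enum.
apply: (T1 x l1 D' l2 u) => //; case: sep => s1 _; exact: s1.
Qed.

End Pass.

End RoundEstimates.

(** * Labellings with few missing labels *)

Section Density.
Variables (R : realType) (Gamma : marked_group).
Notation E := (gens Gamma).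
Notation X := (cube R Gamma).
Notation ball := (graph_ball (@cay Gamma)).
Notation B := (ball_seq Gamma).
Variable lam : probability X R.
Hypothesis lamP : is_lebesgue_power lam.
Notation Ex := (Ex lam).
Notation Pr := (Pr lam).
Notation mean_deficit := (mean_deficit lam).
Implicit Types (c : X -> partial_labelling Gamma).

Lemma local_cell2 N u v (T : Type) (f : 'I_N.+2 -> 'I_N.+2 -> T) :
  local (fun x : X => f (cell N x u) (cell N x v)).
Proof. exact: (local_comp2 f (local_cell R N u) (local_cell R N v)). Qed.

(** Each of the [N+2] cells contains both coordinates with probability at most
    [1/(N+1)^2]. *)
Lemma Pr_collision N u v : u != v ->
  Pr (fun x => cell N x u = cell N x v) <= 2 / N.+1%:R.
Proof.
move=> uv; have N0 : 0 < N.+1%:R :> R by rewrite ltr0n.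
pose P k (x : X) := cell N x u = k /\ cell N x v = k.
have lP k : local (P k) by exact: (local_cell2 _ _ (fun a b => a = k /\ b = k)).
have PrP k : Pr (P k) <= N.+1%:R^-1 ^+ 2.
  rewrite -lee_fin /Pr Ex_prop //.
  rewrite (_ : [set x | P k x] = box [fset u; v]%fset (fun=> disc_itv N k)).
    rewrite lam_box //; last by move=> _; exact: measurable_disc_itv.
    rewrite big_fsetU1 ?big_seq_fset1 ?in_fset1 // expr2 EFinM.
    by apply: lee_pmul => //; exact: disc_itv_le.
  apply/seteqP; split=> x.
    move=> [xu xv] i; rewrite in_fset2 => /orP[] /eqP ->.
      by apply/discE => //; exact: i01_itv.
    by apply/discE => //; exact: i01_itv.
  by move=> h; split; apply/discE; try exact: i01_itv; apply: h; rewrite in_fset2 eqxx ?orbT.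
rewrite /Pr (_ : (fun x => _) = fun x => \sum_k `[< P k x >]%:R); last first.
  apply/funext => x; rewrite (bigD1 (cell N x u)) //= big1 ?addr0.
    by congr (nat_of_bool _)%:R; apply/asbool_equiv_eq; split=> [e|[_ ->]].
  by move=> k /negbTE ku; rewrite asboolF // => -[e _]; rewrite e eqxx in ku.
rewrite Ex_sum; last by move=> k; exact: tame_prop.
apply: le_trans (_ : \sum_(k : 'I_N.+2) N.+1%:R^-1 ^+ 2 <= _).
  by apply: ler_sum => k _; exact: PrP.
rewrite sumr_const card_ord -(mulr_natl _ N.+2) expr2 mulrA ler_wpM2r ?invr_ge0 //.
by rewrite ler_pdivrMr // -natrM ler_nat; lia.
Qed.

Definition cells_separate N m (x : X) := forall u v,
  ball 1%g m u -> ball 1%g m v -> cell N x u = cell N x v -> u = v.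

Lemma local_cells_separate N m : local (cells_separate N m).
Proof.
have [J hJ] := @local_all R Gamma _ _ (B m) (fun v x => cell N x v)
  (fun v => local_cell R N v).
exists J => x y /hJ h; apply/propext.
by split=> sep u v uB vB; [rewrite -!h|rewrite !h]; try exact/ball_seqP; exact: sep.
Qed.

Lemma Pr_not_separate N m :
  Pr (fun x => ~ cells_separate N m x) <= (size (B m))%:R ^+ 2 * (2 / N.+1%:R).
Proof.
pose A u v (x : X) : R := (u != v)%:R * `[< cell N x u = cell N x v >]%:R.
have tA u v : tame (A u v).
  apply: tameM; first exact: tame_cst.
  by apply: tame_prop; exact: (local_cell2 _ _ (fun a b => a = b)).
have A0 u v x : 0 <= A u v x by rewrite mulr_ge0 ?ler0n.
have EA u v : Ex (A u v) <= 2 / N.+1%:R.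
  rewrite /A; have [_|uv] := eqVneq u v.
    rewrite (_ : (fun x => _) = fun=> 0) ?Ex_cst ?divr_ge0 //.
    by apply/funext => x; rewrite mul0r.
  rewrite (_ : (fun x => _) = fun x => `[< cell N x u = cell N x v >]%:R).
    exact: Pr_collision.
  by apply/funext => x; rewrite mul1r.
apply: le_trans (_ : Ex (fun x => \sum_(u <- B m) \sum_(v <- B m) A u v x) <= _).
  apply: Pr_le_Ex.
  - exact: (local_comp not (local_cells_separate N m)).
  - by apply: tame_sum => u; exact: tame_sum.
  - by move=> x; apply: sumr_ge0 => u _; exact: sumr_ge0.
  move=> x; apply: contra_notP => /negP; rewrite -ltNge => lt1 u v uB vB uv.
  apply/eqP; apply: contraTT lt1 => u_v; rewrite -leNgt.
  rewrite (bigD1_seq u) /=; [|exact/ball_seqP|exact: ball_seq_uniq].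
  rewrite (bigD1_seq v) /=; [|exact/ball_seqP|exact: ball_seq_uniq].
  rewrite {1}/A u_v asboolT // mulr1 -addrA lerDl addr_ge0 //.
    by apply: sumr_ge0 => *.
  by apply: sumr_ge0 => w _; apply: sumr_ge0.
rewrite Ex_sum; last by move=> u; exact: tame_sum.
apply: le_trans (_ : \sum_(u <- B m) \sum_(v <- B m) (2 / N.+1%:R) <= _).
  apply: ler_sum => u _; rewrite Ex_sum //; apply: ler_sum => v _; exact: EA.
set t := 2 / _; rewrite !big_const_seq !iter_addr !addr0 !count_predT.
by rewrite -mulrnA -[leLHS]mulr_natl natrM expr2.
Qed.

Section Improve.
Hypothesis bip : exists h : Gamma -> bool, forall u v, cay u v -> h u != h v.

Section Fixed.
Variables (k N : nat).
Let s := (2 * k).+2.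
Let r := (2 * s)%N.
Variable c : X -> partial_labelling Gamma.
Hypothesis fc : fiid_partial c.

Definition only_short_chains x := forall (g p q : E), ~~ long_chain p q k c x (val g).

Definition good_root x :=
  [/\ (0 < deficit (c x) 1%g)%N, cells_separate N (3 * s) x & only_short_chains x].

(** The radius comes from [kempe_repair]: a repair lies within distance [s] of
    the root, so that its vertices are at distance at most [r = 2 * s] from each
    other, and their balls of radius [r] are within distance [3 * s] of the
    root. *)
Lemma good_root_repair x : good_root x ->
  exists (S : {fset Gamma}) t,
    [/\ repair (c x) S t, well_separated r (cell N x) S & 1%g \in S].
Proof.
move=> [d0 sep short]; have cc := fiid_coherent fc x; have [h hP] := bip.
move: d0; rewrite /deficit => /card_gt0P[a]; rewrite !inE => ea.
have [v ev cev] := missing_unlabelled cc ea.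
have cve : c x v 1%g = None.
  case cve : (c x v 1%g) => [b|] //.
  by have [_ e _] := cc _ _ _ cve; rewrite e in cev.
have ve : cay v 1%g by rewrite cay_sym.
have [q vq] := unlabelled_missing cc ve cve.
have sh : chain_iter (c x) (ginv a) q k v = None.
  case/existsP: ev => g /eqP; rewrite mulg1 => vE.
  have := short g (ginv a) q; rewrite /long_chain -vE vq /=.
  by case: (chain_iter _ _ _ _ _).
have [S [t [rep S1 SB]]] := kempe_repair hP cc ev cev ea vq sh.
exists S, t; split=> //; split.
  move=> u w uS wS; rewrite /r mul2n -addnn.
  exact: gball_trans (gball_sym (@cay_sym Gamma) (SB u uS)) (SB w wS).
move=> u uS w z uw uz; apply: sep.
  by apply: gball_le (gball_trans (SB u uS) uw); rewrite /r /s; lia.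
by apply: gball_le (gball_trans (SB u uS) uz); rewrite /r /s; lia.
Qed.

Lemma local_only_short : local only_short_chains.
Proof.
pose L : seq (E * (E * E)) := enum {: E * (E * E)}.
have [J hJ] := @local_all R Gamma _ _ L
  (fun gpq x => long_chain gpq.2.1 gpq.2.2 k c x (val gpq.1))
  (fun gpq => local_long_chain gpq.2.1 gpq.2.2 k (val gpq.1) fc).
exists J => x y /hJ h; apply/propext.
have e (g p q : E) : long_chain p q k c x (val g) = long_chain p q k c y (val g).
  by apply: (h (g, (p, q))); rewrite mem_enum.
by split=> H g p q; [rewrite -e|rewrite e]; exact: H.
Qed.

Lemma local_good_root : local good_root.
Proof.
rewrite (_ : good_root = fun x => (0 < deficit (c x) 1%g)%N /\
   (cells_separate N (3 * s) x /\ only_short_chains x)); last first.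
  by apply/funext => x; apply/propext; split=> [[]|[? []]].
apply: (local_comp2 (fun n P => (0 < n)%N /\ P) (local_deficit 1%g fc)).
exact: (local_comp2 and (local_cells_separate N (3 * s)) local_only_short).
Qed.

Lemma Pr_long_chain_at p q v :
  Pr (fun x => long_chain p q k c x v) <= k.+1%:R^-1.
Proof.
apply: le_trans (Pr_long_chain lamP p q k fc).
rewrite le_eqVlt; apply/orP; left; apply/eqP.
apply: (Ex_translate lamP (f := fun x u => `[< long_chain p q k c x u >]%:R)).
  by move=> u; apply: tame_prop; exact: (local_comp is_true (local_long_chain p q k u fc)).
by move=> g x u; rewrite (long_chain_move p q k (rtrans g) x u fc).
Qed.

(** A root with a missing label is good unless the colours around it collide or
    one of its neighbours starts a long chain, for one of the pairs of labels. *)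
Lemma mean_deficit_le :
  mean_deficit c <= #|{: E}|%:R *
    (Pr good_root + (size (B (3 * s)))%:R ^+ 2 * (2 / N.+1%:R)
     + #|{: E}|%:R ^+ 3 / k.+1%:R).
Proof.
pose L x : R := \sum_(g : E) \sum_(p : E) \sum_(q : E) `[< long_chain p q k c x (val g) >]%:R.
have tl g p q : tame (fun x => `[< long_chain p q k c x (val g) >]%:R : R).
  by apply: tame_prop; exact: (local_comp is_true (local_long_chain p q k _ fc)).
have tL : tame L by do 3 (apply: tame_sum => ?).
have EL : Ex L <= #|{: E}|%:R ^+ 3 / k.+1%:R.
  rewrite /L Ex_sum; last by move=> g; do 2 (apply: tame_sum => ?).
  apply: le_trans (_ : \sum_(g : E) \sum_(p : E) \sum_(q : E) k.+1%:R^-1 <= _).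
    apply: ler_sum => g _; rewrite Ex_sum; last by move=> p; apply: tame_sum => ?.
    apply: ler_sum => p _; rewrite Ex_sum //; apply: ler_sum => q _.
    exact: Pr_long_chain_at.
  set t := _^-1; rewrite !sumr_const -!mulrnA -[leLHS]mulr_natl -natrX.
  by rewrite !expnS expn0 muln1 mulnA.
have tg : tame (fun x => `[< good_root x >]%:R : R) by apply: tame_prop; exact: local_good_root.
have ts : tame (fun x => `[< ~ cells_separate N (3 * s) x >]%:R : R).
  by apply: tame_prop; exact: (local_comp not (local_cells_separate N (3 * s))).
pose f x : R := `[< good_root x >]%:R + `[< ~ cells_separate N (3 * s) x >]%:R + L x.
have tf : tame f by do 2 (apply: tameD => //).
have Ef : Ex f <= Pr good_root + (size (B (3 * s)))%:R ^+ 2 * (2 / N.+1%:R)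
     + #|{: E}|%:R ^+ 3 / k.+1%:R.
  rewrite /f ExD //; last exact: tameD.
  rewrite ExD // lerD // lerD2l; exact: Pr_not_separate.
apply: le_trans (ler_wpM2l (ler0n _ _) Ef).
rewrite -ExZ //; apply: Ex_le.
- exact: tame_deficit.
- by apply: tameM => //; exact: tame_cst.
move=> x.
have L0 : 0 <= L x by do 3 (apply: sumr_ge0 => ? _); rewrite ler0n.
have f0 : 0 <= f x by rewrite !addr_ge0 ?ler0n.
have [->|d0] := posnP (deficit (c x) 1%g); first by rewrite mulr_ge0 ?ler0n.
apply: le_trans (_ : #|{: E}|%:R <= _); first by rewrite ler_nat; exact: deficit_le.
rewrite ler_peMr ?ler0n // /f.
have [sep|nsep] := pselect (cells_separate N (3 * s) x); last first.
  by rewrite (asboolT nsep) addrAC lerDr addr_ge0 ?ler0n.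
have [short|nshort] := pselect (only_short_chains x).
  have good : good_root x by split.
  by rewrite (asboolT good) -addrA lerDl addr_ge0 ?ler0n.
rewrite (le_trans (_ : 1 <= L x)) ?lerDr ?addr_ge0 ?ler0n //.
have [g /existsNP[p /existsNP[q /negP]]] : exists g : E, ~ forall p q : E,
    ~~ long_chain p q k c x (val g) by apply/existsNP.
rewrite negbK => lc.
rewrite /L (bigD1 g) //= (bigD1 p) //= (bigD1 q) //= asboolT // -!addrA lerDl.
rewrite !addr_ge0 //; do ?(apply: sumr_ge0 => ? _); rewrite ?ler0n //.
Qed.

Lemma improve_fixed : exists2 c', fiid_partial c' &
  Pr good_root <= (size (B r))%:R ^+ 2 * (mean_deficit c - mean_deficit c').
Proof.
have r0 : (0 < r)%N by [].
have [c' fc' h] := pass lamP N fc r0; exists c' => //; apply: h.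
  exact: local_good_root.
exact: good_root_repair.
Qed.

End Fixed.

Lemma exists_le_inv (a e : R) : 0 <= a -> 0 < e -> exists k : nat, a / k.+1%:R <= e.
Proof.
move=> a0 e0; exists (Num.truncn (a / e)).
rewrite ler_pdivrMr ?ltr0n // -ler_pdivrMl // mulrC ltW //.
exact: truncnS_gt.
Qed.

(** First [k] is chosen so that long chains are rare enough, then [N] so that
    collisions within the corresponding radius are.  The gain depends on these
    choices, but not on [c]. *)
Lemma improve e : 0 < e -> exists2 kappa, 0 < kappa &
  forall c, fiid_partial c -> e <= mean_deficit c ->
  exists2 c', fiid_partial c' & mean_deficit c' <= mean_deficit c - kappa.
Proof.
move=> e0; pose n := #|{: E}|%:R : R; have n0 : 0 <= n by exact: ler0n.
pose d := e / (4 * (n + 1)).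
have d0 : 0 < d by rewrite divr_gt0 // mulr_gt0 // ltr_pwDr.
have [k hk] := exists_le_inv (exprn_ge0 3 n0) d0.
set s := (2 * k).+2; pose b := (size (B (3 * s)))%:R ^+ 2 : R.
have b0 : 0 <= b * 2 by rewrite mulr_ge0 // exprn_ge0.
have [N hN] := exists_le_inv b0 d0.
pose C := (size (B (2 * s)))%:R ^+ 2 : R.
have C0 : 0 < C.
  by rewrite exprn_gt0 // ltr0n; have := ball_seq1 Gamma (2 * s); case: (B (2 * s)).
exists (d / C); first exact: divr_gt0.
move=> c fc ec; have [c' fc' h] := improve_fixed k N fc; exists c' => //.
have := mean_deficit_le k N fc; move: h.
rewrite -/s -/n -/C -/b; set P := Pr _; move: (mean_deficit c) (mean_deficit c') ec => m m' em h1 h2.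
rewrite lerBrDr -lerBrDl ler_pdivrMr // mulrC; apply: le_trans h1.
have e_d : e = d * (4 * (n + 1)).
  by rewrite /d divfK // mulf_neq0 // gt_eqF // ltr_pwDr.
rewrite -mulrA in hN.
have : m <= n * (P + d + d) by apply: le_trans h2 _; rewrite ler_wpM2l // lerD // lerD.
move: em; rewrite e_d => h3 h4.
rewrite leNgt; apply/negP => Pd.
have : n * (P + d + d) <= n * (3 * d) by rewrite ler_wpM2l //; lra.
have : n * (3 * d) < d * (4 * (n + 1)) by nra.
lra.
Qed.

Lemma fiid_empty : fiid_partial (fun (_ : X) (_ _ : Gamma) => None).
Proof. by split=> // u v; exists [::]. Qed.

(** The expected number of missing labels is at most the number of labels, and
    each pass lowers it by [kappa] until it is below [e]. *)
Lemma small_deficit e : 0 < e -> exists2 c, fiid_partial c & mean_deficit c < e.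
Proof.
move=> e0; have [kappa k0 imp] := improve e0.
pose n := #|{: E}|%:R : R.
have mean_le c : fiid_partial c -> mean_deficit c <= n.
  move=> fc; rewrite -[X in _ <= X](Ex_cst lam); apply: Ex_le.
  - exact: tame_deficit.
  - exact: tame_cst.
  by move=> x; rewrite ler_nat; exact: deficit_le.
have iter j : exists2 c, fiid_partial c &
    mean_deficit c < e \/ mean_deficit c <= n - j%:R * kappa.
  elim: j => [|j [c fc [lt|le]]].
  - exists (fun _ _ _ => None); first exact: fiid_empty.
    by right; rewrite mul0r subr0; apply: mean_le; exact: fiid_empty.
  - by exists c => //; left.
  have [lt|ge] := ltP (mean_deficit c) e; first by exists c => //; left.
  have [c' fc' le'] := imp c fc ge; exists c' => //; right.
  by rewrite -natr1 mulrDl mul1r opprD addrA (le_trans le') // lerD2r.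
have [c fc [lt|le]] := iter (Num.truncn (n / kappa)).+1; first by exists c.
have : 0 <= mean_deficit c by apply: Ex_ge0 => x; rewrite ler0n.
have : n < (Num.truncn (n / kappa)).+1%:R * kappa.
  by rewrite -ltr_pdivrMr //; exact: truncnS_gt.
by move=> h1 h2; exfalso; lra.
Qed.

End Improve.
End Density.

(** * Comparison of balls *)

Section Words.
Variable Gamma : marked_group.
Notation E := (gens Gamma).
Notation ball := (graph_ball (@cay Gamma)).
Implicit Types (c : partial_labelling Gamma) (u v : Gamma) (a b : E) (w : seq E).

Fixpoint run c u w : option Gamma :=
  if w is a :: w' then obind (fun v => run c v w') (nbr c u a) else Some u.

Lemma run_cat c u w w' : run c u (w ++ w') = obind (fun v => run c v w') (run c u w).
Proof. by elim: w u => [|a w IHw] u //=; case: (nbr c u a) => /=. Qed.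

Lemma nbr_ginv c u v a : coherent c -> nbr c u a = Some v -> nbr c v (ginv a) = Some u.
Proof. by move=> cc /(nbrP _ _ _ cc)/cc[_ h _]; apply/nbrP. Qed.

(** A letter followed by its inverse is a step back and forth. *)
Lemma run_cancel c u v w a w' : coherent c ->
  run c u (w ++ a :: ginv a :: w') = Some v -> run c u (w ++ w') = Some v.
Proof.
move=> cc; rewrite !run_cat; case: (run c u w) => //= x.
by case e : (nbr c x a) => [y|] //=; rewrite (nbr_ginv cc e).
Qed.

Definition winv w : seq E := rev (map (@ginv Gamma) w).

Lemma winvK : involutive winv.
Proof.
by move=> w; rewrite /winv map_rev revK -map_comp map_id_in // => a _; exact: ginvK.
Qed.

Lemma run_winv c u v w : coherent c -> run c u w = Some v -> run c v (winv w) = Some u.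
Proof.
move=> cc; elim: w u => [|a w IHw] u /=; first by case=> ->.
case e : (nbr c u a) => [x|] //= /IHw h.
by rewrite /winv /= rev_cons -cats1 run_cat -/(winv w) h /= (nbr_ginv cc e).
Qed.

Fixpoint trace c u w : seq Gamma :=
  if w is a :: w' then
    if nbr c u a is Some v then v :: trace c v w' else [::]
  else [::].

Lemma traceP c u v w : coherent c -> run c u w = Some v ->
  [/\ path (@cay Gamma) u (trace c u w), last u (trace c u w) = v &
      size (trace c u w) = size w].
Proof.
move=> cc; elim: w u => [|a w IHw] u /=; first by case.
case e : (nbr c u a) => [x|] //= /IHw[p l ->]; split=> //.
by move/(nbrP _ _ _ cc): e => /cc[-> _ _].
Qed.

Lemma run_ball c u v w : coherent c -> run c u w = Some v -> ball u (size w) v.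
Proof. by move=> cc /(traceP cc)[p l s]; exists (trace c u w); rewrite s. Qed.

Lemma run_take c u w i v : run c u w = Some v -> (i < size w)%N ->
  run c u (take i.+1 w) = Some (nth u (trace c u w) i).
Proof.
have gen x0 : run c u w = Some v -> (i < size w)%N ->
    run c u (take i.+1 w) = Some (nth x0 (trace c u w) i).
  elim: w u i => [|a w IHw] u' [|i] //=; case: (nbr c u' a) => //= x.
    by rewrite take0.
  exact: IHw.
exact: gen.
Qed.

Definition reduced w := sorted (fun a b => b != ginv a) w.

Lemma not_reduced w : ~~ reduced w -> exists w1 a w2, w = w1 ++ a :: ginv a :: w2.
Proof.
elim: w => [|a [|b w] IHw] //=.
rewrite negb_and negbK => /orP[/eqP ->|/IHw[w1 [a' [w2 ->]]]].
  by exists [::], a, w.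
by exists (a :: w1), a', w2.
Qed.

Lemma reduced_mid w1 w2 w3 : reduced (w1 ++ w2 ++ w3) -> reduced w2.
Proof. by rewrite /reduced => /cat_sorted2[_ /cat_sorted2[]]. Qed.

(** A reduced word is followed without backtracking.  If the walk visits a
    vertex twice, a shorter closed walk appears; otherwise it is a simple cycle,
    whose length is at most 2 by acyclicity.  Length 1 would be a loop, and
    length 2 would be a backtracking. *)
Lemma reduced_closed c u w : irreflexive (@cay Gamma) -> graph_acyclic (@cay Gamma) ->
  coherent c -> reduced w -> run c u w = Some u -> w = [::].
Proof.
move=> irr acyc cc; have [k] := ubnP (size w).
elim: k w u => // k IHk w u; rewrite ltnS => wk red wu.
case: w red wu wk => [|a0 w0] //; set w := a0 :: w0 => red wu wk; exfalso.
have [pw lw sw] := traceP cc wu.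
have cyc : path.cycle (@cay Gamma) (trace c u w).
  move: pw; rewrite -{1}lw; case: (trace c u w) => [|y t] //= /andP[yt pt].
  by rewrite rcons_path pt yt.
have [Ut|/(uniqPn u)[i [j [ij jt eqij]]]] := boolP (uniq (trace c u w)).
  have := acyc (trace c u w); rewrite /ucycle cyc Ut sw => /(_ isT).
  move: red wu; rewrite /w; case: w0 {w wk pw lw sw cyc Ut} => [|b [|? ?]] //=.
    move=> _; case e : (nbr c u a0) => [x|] //= -[xu] _.
    by move/(nbrP _ _ _ cc): e => /cc[]; rewrite xu irr.
  rewrite andbT => /eqP red; case e : (nbr c u a0) => [x|] //=.
  case e' : (nbr c x b) => [y|] //= -[yu] _; subst y; apply: red.
  have := proj1 (nbrP _ _ _ cc) (nbr_ginv cc e).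
  by rewrite (proj1 (nbrP _ _ _ cc) e') => -[->].
have jw : (j < size w)%N by rewrite -sw.
have iw : (i < size w)%N by exact: ltn_trans jw.
pose w2 := take (j - i) (drop i.+1 w).
have wE : take j.+1 w = take i.+1 w ++ w2.
  by rewrite /w2 -takeD; congr take; lia.
have := run_take wu jw; rewrite wE run_cat (run_take wu iw) /= -eqij => w2u.
have sw2 : size w2 = (j - i)%N by rewrite size_takel // size_drop; lia.
have : w2 = [::].
  apply: IHk w2u; first by rewrite sw2; lia.
  apply: (@reduced_mid (take i.+1 w) _ (drop j.+1 w)).
  by rewrite catA -wE cat_take_drop.
by move/(congr1 size); rewrite sw2 /=; lia.
Qed.

Section Transfer.
Hypotheses (irr : irreflexive (@cay Gamma)) (acyc : graph_acyclic (@cay Gamma)).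

Definition complete n c :=
  coherent c /\ forall v a, ball 1%g n v -> has_label c v a.

Lemma complete_run n c w : complete n c -> (size w <= n.+1)%N -> run c 1%g w <> None.
Proof.
move=> [cc full]; elim/last_ind: w => [|w a IHw] //.
rewrite size_rcons ltnS => wn; rewrite -cats1 run_cat.
case e : (run c 1%g w) => [v|] /=; last by have := IHw (leqW wn); rewrite e.
have /(has_labelP _ _ cc)[x vx] : has_label c v a.
  by apply: full; apply: gball_le (run_ball cc e).
by rewrite (proj2 (nbrP _ _ _ cc) vx).
Qed.

(** In a tree a closed walk can be shortened to the trivial one by cancelling a
    letter against its inverse, and these cancellations are visible on the word
    alone. *)
Lemma closed_transfer c c' n w : coherent c -> complete n c' -> (size w <= n.+1)%N ->
  run c 1%g w = Some 1%g -> run c' 1%g w = Some 1%g.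
Proof.
move=> cc cc'; have [k] := ubnP (size w).
elim: k w => // k IHk w wk wn wu.
have [red|/not_reduced[w1 [a [w2 wE]]]] := boolP (reduced w).
  by rewrite (reduced_closed irr acyc cc red wu).
have full := complete_run cc' wn.
case e : (run c' 1%g w) => [v|] //; rewrite wE in e wu wk wn.
move: wk wn; rewrite size_cat /= => wk wn.
rewrite -(run_cancel (proj1 cc') e); apply: IHk (run_cancel cc wu).
  by rewrite size_cat; lia.
by rewrite size_cat; lia.
Qed.

Lemma run_transfer c c' n w w' u : coherent c -> complete n c' ->
  (size w + size w' <= n.+1)%N ->
  run c 1%g w = Some u -> run c 1%g w' = Some u -> run c' 1%g w = run c' 1%g w'.
Proof.
move=> cc cc' ww' wu w'u.
have : run c 1%g (w ++ winv w') = Some 1%g.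
  by rewrite run_cat wu /=; exact: run_winv.
move/(closed_transfer cc cc'); rewrite size_cat size_rev size_map => /(_ ww').
rewrite run_cat; case e : (run c' 1%g w) => [v|] //=.
by move/(run_winv (proj1 cc')); rewrite winvK.
Qed.

Lemma complete_reach n c v r : complete n c -> (r <= n.+1)%N -> ball 1%g r v ->
  exists2 w, (size w <= r)%N & run c 1%g w = Some v.
Proof.
move=> [cc full]; elim: r v => [|r IHr] v rn.
  by move=> [[|? ?] [_ /= <-]] //; exists [::].
move=> /ballS[/(IHr _ (ltnW rn))[w wr wv]|[u ur uv]].
  by exists w => //; exact: leqW.
have [w wr wu] := IHr _ (ltnW rn) ur.
case e : (c u v) => [a|]; last first.
  have [a /negP[]] := unlabelled_missing cc uv e.
  by apply: full; exact: gball_le ur.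
exists (rcons w a); first by rewrite size_rcons.
by rewrite -cats1 run_cat wu /= (proj2 (nbrP _ _ _ cc) e).
Qed.

Section Develop.
Variable r : nat.
Let m := (2 * r)%N.

Definition address c v : seq E :=
  if pselect (exists w, (size w <= r)%N /\ run c 1%g w = Some v) is left h
  then projT1 (cid h) else [::].

(** The isomorphism sends a vertex to the end of the walk of [c'] that spells the
    same word as a walk of [c] leading to this vertex. *)
Definition develop c c' v : Gamma := odflt 1%g (run c' 1%g (address c v)).

Lemma addressP c v : complete m c -> ball 1%g r v ->
  (size (address c v) <= r)%N /\ run c 1%g (address c v) = Some v.
Proof.
move=> cc vr; rewrite /address; case: pselect => [h|[]]; first exact: (projT2 (cid h)).
have [|w ? ?] := complete_reach cc _ vr; first by rewrite /m; lia.
by exists w.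
Qed.

Lemma developP c c' v : complete m c -> complete m c' -> ball 1%g r v ->
  run c' 1%g (address c v) = Some (develop c c' v).
Proof.
move=> cc cc' vr; have [sw _] := addressP cc vr.
rewrite /develop; have := @complete_run _ _ (address c v) cc'.
by case: (run _ _ _) => //= h; exfalso; apply: h => //; rewrite /m; lia.
Qed.

Lemma develop_ball c c' v : complete m c -> complete m c' -> ball 1%g r v ->
  ball 1%g r (develop c c' v).
Proof.
move=> cc cc' vr; have [sw _] := addressP cc vr.
exact: gball_le sw (run_ball (proj1 cc') (developP cc cc' vr)).
Qed.

Lemma developK c c' v : complete m c -> complete m c' -> ball 1%g r v ->
  develop c' c (develop c c' v) = v.
Proof.
move=> cc cc' vr; have [sw wv] := addressP cc vr.
have v'r := develop_ball cc cc' vr; have [sw' wv'] := addressP cc' v'r.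
have e := developP cc' cc v'r.
apply: Some_inj; rewrite -e -wv.
by apply: (run_transfer (proj1 cc') cc _ wv' (developP cc cc' vr)); rewrite /m; lia.
Qed.

Lemma develop1 c c' : complete m c -> complete m c' -> develop c c' 1%g = 1%g.
Proof.
move=> cc cc'; have vr := gball_refl (@cay Gamma) 1%g r.
have [sw wv] := addressP cc vr.
apply: Some_inj; rewrite -(developP cc cc' vr).
by rewrite (run_transfer (w' := [::]) (proj1 cc) cc' _ wv) //= /m; lia.
Qed.

(** The address of [u] followed by [a] and the address of [v] lead to the same
    vertex in [c], hence also in [c'].  Together they have length [2 * r + 1],
    which is the reason for asking for completeness up to distance [2 * r]. *)
Lemma develop_label c c' u v a : complete m c -> complete m c' ->
  ball 1%g r u -> ball 1%g r v ->
  c u v = Some a -> c' (develop c c' u) (develop c c' v) = Some a.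
Proof.
move=> cc cc' ur vr uv.
have [su wu] := addressP cc ur; have [sv wv] := addressP cc vr.
apply/(nbrP _ _ _ (proj1 cc')).
have h : run c 1%g (rcons (address c u) a) = Some v.
  by rewrite -cats1 run_cat wu /= (proj2 (nbrP _ _ _ (proj1 cc)) uv).
have := run_transfer (proj1 cc) cc' _ h wv.
rewrite (developP cc cc' vr) -cats1 run_cat (developP cc cc' ur) /= size_cat /=.
by move=> <-; [case: (nbr _ _ _)|rewrite /m; lia].
Qed.

Lemma develop_labelE c c' u v : complete m c -> complete m c' ->
  ball 1%g r u -> ball 1%g r v ->
  c' (develop c c' u) (develop c c' v) = c u v.
Proof.
move=> cc cc' ur vr.
case e : (c u v) => [a|]; first exact: develop_label.
case e' : (c' _ _) => [a|] //.
have := develop_label cc' cc (develop_ball cc cc' ur) (develop_ball cc cc' vr) e'.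
by rewrite !developK // e.
Qed.

Lemma complete_adj c u v : complete m c -> ball 1%g r u ->
  cay u v = (c u v != None).
Proof.
move=> [cc full] ur; apply/idP/idP => [uv|].
  apply/eqP => cuv; have [a /negP[]] := unlabelled_missing cc uv cuv.
  by apply: full; apply: gball_le ur; rewrite /m; lia.
by case e : (c u v) => [a|] // _; have [] := cc _ _ _ e.
Qed.

(** The standard diagram labels the pair [(g * x, x)] by [g], which is the label
    found at the end [x], whence the exchange of the two ends. *)
Definition to_labelling c : labelling Gamma := fun e =>
  odflt (head (std_diagram e) (enum {: E})) (c (val e).2 (val e).1).

(** Both labellings look like the Cayley diagram within distance [2 * r], and
    a tree is simply connected, so that [develop] is an isomorphism of the
    balls of radius [r]. *)
Lemma complete_iso c c' : complete m c -> complete m c' ->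
  rooted_lgraph_iso (labelled_ball r (to_labelling c))
                    (labelled_ball r (to_labelling c')).
Proof.
move=> cc cc'.
pose T := set_type (ball 1%g r).
have dev_in c1 c2 (h1 : complete m c1) (h2 : complete m c2) (u : T) :
    develop c1 c2 (val u) \in ball 1%g r.
  apply: mem_set; apply: develop_ball => //; exact: set_mem (valP u).
pose phi (u : T) : T := SigSub (dev_in c c' cc cc' u).
pose psi (u : T) : T := SigSub (dev_in c' c cc' cc u).
have uB (u : T) : ball 1%g r (val u) by exact: set_mem (valP u).
exists phi; split.
- exists psi => u; apply: val_inj; exact: developK.
- apply: val_inj; exact: develop1.
- move=> u v /=; rewrite (complete_adj _ cc' (uB (phi u))) (complete_adj _ cc (uB u)).
  by rewrite (develop_labelE cc cc' (uB u) (uB v)).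
- move=> u v h h' /=; rewrite /to_labelling /=.
  have : c (val v) (val u) != None.
    by rewrite -(complete_adj _ cc (uB v)) cay_sym.
  rewrite (develop_labelE cc cc' (uB v) (uB u)).
  by case: (c _ _).
Qed.

End Develop.
End Transfer.

Definition std_partial : partial_labelling Gamma := fun u v => insub (v * u^-1)%g.

Lemma std_partialP u v a : std_partial u v = Some a <-> v = (val a * u)%g.
Proof.
rewrite /std_partial; split.
  by case: insubP => [b _ vE|] // [<-]; rewrite vE mulgVK.
move=> ->; rewrite mulgK; exact: valK.
Qed.

Lemma std_partial_complete n : complete n std_partial.
Proof.
have cc : coherent std_partial.
  move=> u v a /std_partialP ->; split; first exact: cayM.
    by apply/std_partialP; rewrite /= mulKg.
  by move=> v' /std_partialP.
split=> // v a _; apply/has_labelP => //; exists (val a * v)%g; exact/std_partialP.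
Qed.

Lemma std_partial_labelling : to_labelling std_partial = @std_diagram Gamma.
Proof.
apply/funext => e; rewrite /to_labelling.
suff -> : std_partial (val e).2 (val e).1 = Some (std_diagram e) by [].
by apply/std_partialP; rewrite /= mulgVK.
Qed.

End Words.

(** * The approximate Cayley diagram *)

Section Final.
Variables (R : realType) (Gamma : marked_group).
Notation E := (gens Gamma).
Notation X := (cube R Gamma).
Notation ball := (graph_ball (@cay Gamma)).
Notation B := (ball_seq Gamma).
Variable lam : probability X R.
Hypothesis lamP : is_lebesgue_power lam.
Notation Ex := (Ex lam).
Notation Pr := (Pr lam).
Notation mean_deficit := (mean_deficit lam).
Variable c : X -> partial_labelling Gamma.
Hypothesis fc : fiid_partial c.

Definition random_labelling (x : X) : labelling Gamma := to_labelling (c x).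

Lemma local_random_labelling u : local (fun x => random_labelling x u).
Proof.
apply: (local_comp (odflt (head (std_diagram u) (enum {: E})))).
exact: fiid_local.
Qed.

(** The fallback label used for an unlabelled edge is the first generator, so
    that it is the same for all edges; this keeps equivariance. *)
Lemma random_labelling_fiid : is_fiid_labelling lam random_labelling.
Proof.
split=> [u l|].
  apply: local_measurable.
  exact: (local_comp (fun a => a = l) (local_random_labelling u)).
apply: aeW => x phi; apply/funext => u.
rewrite /random_labelling -/(act phi x) (fiid_move fc).
rewrite /act_edge /to_labelling /move /=.
have : std_diagram u \in enum {: E} by rewrite mem_enum.
by case: (enum _).
Qed.

Definition ball_std r x := rooted_lgraph_iso
  (labelled_ball r (random_labelling x)) (labelled_ball r (@std_diagram Gamma)).

Lemma local_ball_std r : local (ball_std r).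
Proof.
have [J hJ] := fiid_agree 0 (B r) fc.
exists J => x y /hJ[_ h]; rewrite /ball_std.
suff -> : labelled_ball r (random_labelling x) = labelled_ball r (random_labelling y) by [].
rewrite /labelled_ball; congr RootedLGraph.
apply: functional_extensionality_dep => u; apply: functional_extensionality_dep => v.
apply/funext => e; rewrite /random_labelling /to_labelling /= h //.
  by apply/ball_seqP; exact: set_mem (valP v).
by apply/ball_seqP; exact: set_mem (valP u).
Qed.

Lemma Ex_deficit u : Ex (fun x => (deficit (c x) u)%:R) = mean_deficit c.
Proof.
apply: (Ex_translate lamP (f := fun x u => (deficit (c x) u)%:R)).
  by move=> v; exact: tame_deficit.
by move=> g x v; rewrite (fiid_deficit_move (rtrans g) x v fc).
Qed.

(** If no vertex of the ball of radius [2 * r] misses a label, the ball of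
    radius [r] is standard. *)
Lemma ball_std_estimate r : irreflexive (@cay Gamma) -> graph_acyclic (@cay Gamma) ->
  1 - (size (B (2 * r)))%:R * mean_deficit c <= Pr (ball_std r).
Proof.
move=> irr acyc.
have tI : tame (fun x => `[< ball_std r x >]%:R : R) by apply: tame_prop; exact: local_ball_std.
have tD u : tame (fun x => (deficit (c x) u)%:R : R) by exact: tame_deficit.
rewrite lerBlDr mulr_natl -(count_predT (B (2 * r))) -[_ *+ _]addr0 -iter_addr -big_const_seq.
rewrite (eq_bigr (fun u => Ex (fun x => (deficit (c x) u)%:R))); last first.
  by move=> u _; rewrite Ex_deficit.
rewrite -Ex_sum // -ExD //; last exact: tame_sum.
rewrite -[X in X <= _](Ex_cst lam); apply: Ex_le; first exact: tame_cst.
  by apply: tameD => //; exact: tame_sum.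
move=> x; have s0 : 0 <= \sum_(u <- B (2 * r)) (deficit (c x) u)%:R :> R.
  by apply: sumr_ge0 => u _; rewrite ler0n.
have [good|bad] := pselect (forall u, ball 1%g (2 * r) u -> deficit (c x) u = 0%N).
  rewrite asboolT ?lerDl // /ball_std -std_partial_labelling.
  apply: complete_iso => //; last exact: std_partial_complete.
  split; first exact: fiid_coherent.
  by move=> v a /good /card0_eq /(_ a); rewrite !inE => /negbT; rewrite negbK.
rewrite (le_trans (_ : 1 <= \sum_(u <- B (2 * r)) (deficit (c x) u)%:R)) ?lerDr //.
have /existsNP[u /not_implyP[/ball_seqP uB /eqP]] := bad.
rewrite -lt0n (bigD1_seq u uB (ball_seq_uniq _ _)) /= => d0.
rewrite (le_trans (_ : 1 <= (deficit (c x) u)%:R)) ?ler1n // lerDl.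
by apply: sumr_ge0 => v _; rewrite ler0n.
Qed.

End Final.

Theorem theorem1p6 (R : realType) (n : nat) (Gamma : marked_group)
    (lam : probability (cube R Gamma) R) :
  is_lebesgue_power lam ->
  is_regular_tree (@cay Gamma) n ->
  exists f : nat -> cube R Gamma -> labelling Gamma,
    is_fiid_approx_cayley_diagram lam f.
Proof.
move=> lamP [sym irr con acyc _].
have bip := tree_bipartite 1%g sym irr con acyc.
have small i : exists c, fiid_partial c /\ mean_deficit lam c < harmonic i.
  by have [|c fc lt] := small_deficit lamP bip (e := harmonic i); [exact: harmonic_gt0|exists c].
pose c i := projT1 (cid (small i)).
have fc i : fiid_partial (c i) by have [] := projT2 (cid (small i)).
have lt i : mean_deficit lam (c i) < harmonic i by have [] := projT2 (cid (small i)).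
exists (fun i => random_labelling (c i)); split=> [i|r].
  exact: random_labelling_fiid.
rewrite (_ : (fun i => _) = EFin \o (fun i => Pr lam (ball_std (c i) r))); last first.
  by apply/funext => i; rewrite /= /Pr Ex_prop //; exact: local_ball_std.
apply: cvg_EFin; first by near=> i.
rewrite /comp /=.
pose b := (size (ball_seq Gamma (2 * r)))%:R : R.
apply: (@squeeze_cvgr _ _ _ _ (fun i => 1 - b * harmonic i) (fun=> 1)).
- near=> i; apply/andP; split.
    apply: le_trans (ball_std_estimate lamP (fc i) r irr acyc).
    by rewrite lerD2l lerN2 ler_wpM2l ?ler0n // ltW.
  rewrite -[X in _ <= X](Ex_cst lam); apply: Ex_le => [||x].
  + by apply: tame_prop; exact: local_ball_std.
  + exact: tame_cst.
  + by case: `[< _ >]; rewrite ?ler01 // lexx.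
- rewrite -[X in _ --> X](subr0 1) -[X in _ - X](mulr0 b).
  apply: cvgB; first exact: cvg_cst.
  by apply: cvgMr; exact: cvg_harmonic.
- exact: cvg_cst.
Unshelve. all: by end_near.
Qed.
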